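(* Let $m,n\ge1$. The family $\mathcal K_{m,n}$ is a closed totally geodesic submanifold of $\mathbb S_{++}^{mn}$ under the affine-invariant Riemannian metric. Hence every $M\in\mathbb S_{++}^{mn}$ has a unique projection $$G_\star=P_{\mathcal K}(M)=\operatorname*{arg\,min}_{G\in\mathcal K_{m,n}}d_{\mathrm{AI}}(M,G).$$ If $R_\star=\log(G_\star^{-1/2}MG_\star^{-1/2})$, then $$\operatorname{Tr}_B(R_\star)=0,\qquad \operatorname{Tr}_A(R_\star)=0.$$ Conversely, any $G\in\mathcal K_{m,n}$ such that $R=\log(G^{-1/2}MG^{-1/2})$ satisfies $\operatorname{Tr}_B(R)=0$ and $\operatorname{Tr}_A(R)=0$ equals $G_\star$. Therefore $$d_{\mathrm{AI}}(M,\mathcal K_{m,n})=\|R_\star\|_F.$$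
   Context: $\mathbb S^d$ denotes real symmetric $d\times d$ matrices and $\mathbb S_{++}^d$ the positive-definite ones. The affine-invariant Riemannian metric on $\mathbb S_{++}^d$ is $\|Z\|_{S,\mathrm{AI}}=\|S^{-1/2}ZS^{-1/2}\|_F$, with distance $d_{\mathrm{AI}}(S_0,S_1)=\|\log(S_0^{-1/2}S_1S_0^{-1/2})\|_F$; the distance to a set is the infimum of distances to its points. The Kronecker family is $\mathcal K_{m,n}=\{B\otimes A: A\in\mathbb S_{++}^m,\ B\in\mathbb S_{++}^n\}\subset\mathbb S_{++}^{mn}$. For $L\in\mathbb S^{mn}$ written as $L=[L_{pq}]_{p,q=1}^n$ with $m\times m$ blocks, the partial traces are $\operatorname{Tr}_B(L)=\sum_{p=1}^nL_{pp}$ and $\operatorname{Tr}_A(L)=[\operatorname{tr}(L_{pq})]_{p,q=1}^n$. *)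

(* Defs.v *)
From mathcomp Require Import all_boot all_order all_algebra.
From mathcomp Require Import all_classical all_reals all_analysis.
From mathcomp Require Export mxtens.
Import Order.TTheory GRing.Theory Num.Theory.
Import numFieldNormedType.Exports.

Set Implicit Arguments.
Unset Strict Implicit.
Unset Printing Implicit Defensive.

Local Open Scope classical_set_scope.
Local Open Scope ring_scope.

Section MatrixFunctions.
Context {R : realType} {d : nat}.
Implicit Types (S X Y Z : 'M[R]_d).

Definition spd : set 'M[R]_d :=
  [set S | S \is symmetricmx /\
           forall x : 'cV[R]_d, x != 0 -> 0 < (x^T *m S *m x) 0 0].

(* Spectral calculus: f applied to the eigenvalues of a symmetric matrix.  The
   value is independent of the diagonalization by [mxfunE]; it is 0 on matrices
   that are not orthogonally diagonalizable. *)
Definition mxfun (f : R -> R) S : 'M[R]_d :=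
  xget 0 [set T | exists U : 'M[R]_d, exists s : 'rV[R]_d,
    [/\ U^T *m U = 1%:M, S = U^T *m diag_mx s *m U
      & T = U^T *m diag_mx (map_mx f s) *m U]].

Lemma mxfunE (f : R -> R) S (U : 'M[R]_d) (s : 'rV[R]_d) :
  U^T *m U = 1%:M -> S = U^T *m diag_mx s *m U ->
  mxfun f S = U^T *m diag_mx (map_mx f s) *m U.
Proof.
move=> UU defS; rewrite /mxfun; apply: xget_unique; first by exists U, s.
move=> _ [V [t [VV defS' ->]]].
have UU' : U *m U^T = 1%:M by apply: mulmx1C.
have VV' : V *m V^T = 1%:M by apply: mulmx1C.
have comm : (V *m U^T) *m diag_mx s = diag_mx t *m (V *m U^T).
  have := congr1 (fun T => V *m T *m U^T) (etrans (esym defS) defS').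
  by rewrite /= !mulmxA VV' mul1mx -mulmxA UU' mulmx1 -!mulmxA.
have commf : V *m U^T *m diag_mx (map_mx f s)
           = diag_mx (map_mx f t) *m (V *m U^T).
  apply/matrixP => i j; have := congr1 (fun T : 'M[R]_d => T i j) comm.
  rewrite !mul_mx_diag !mul_diag_mx ![(\matrix_(_, _) _) _ _]mxE.
  rewrite ![map_mx _ _ _ _]mxE.
  rewrite (mulrC (t 0 i)) (mulrC (f (t 0 i))).
  have [->|w0] := eqVneq ((V *m U^T) i j) 0; first by rewrite !mul0r.
  by move=> /(mulfI w0) ->.
have := congr1 (fun T => V^T *m T *m U) commf.
rewrite /= !mulmxA VV mul1mx => ->.
by rewrite -!mulmxA UU mulmx1.
Qed.

Definition mxlog S := mxfun (@ln R) S.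
Definition mxsqrt S := mxfun (@Num.sqrt R) S.
Definition mxinvsqrt S := invmx (mxsqrt S).

Definition frob_dot X Y := \tr (X^T *m Y).
Definition frob_norm X := Num.sqrt (frob_dot X X).

Definition whiten S Z := mxinvsqrt S *m Z *m mxinvsqrt S.

(* The inner product on the tangent space at S: the polarization of the
   affine-invariant norm. *)
Definition ai_dot S X Y := frob_dot (whiten S X) (whiten S Y).
Definition ai_norm S Z := frob_norm (whiten S Z).

Lemma ai_normE S Z : ai_norm S Z = Num.sqrt (ai_dot S Z Z).
Proof. by []. Qed.

Definition ai_dist S0 S1 := frob_norm (mxlog (whiten S0 S1)).

Definition ai_dist_set S (K : set 'M[R]_d) :=
  inf [set ai_dist S G | G in K].

Definition ai_proj S (K : set 'M[R]_d) G :=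
  K G /\ forall G', K G' -> ai_dist S G <= ai_dist S G'.

End MatrixFunctions.

Section Submanifolds.
Context {R : realType}.

(* In finite dimension, f is C^k on the open set U. *)
Fixpoint Ck_on (V W : normedModType R) (k : nat) (U : set V) (f : V -> W)
    : Prop :=
  if k is k'.+1 then
    (forall x, U x -> differentiable f x) /\ (forall v, Ck_on k' U ('D_v f))
  else forall x, U x -> {for x, continuous f}.

Definition smooth_on (V W : normedModType R) (U : set V) (f : V -> W) :=
  forall k, Ck_on k U f.

Definition closed_in (T : topologicalType) (A K : set T) :=
  exists2 C, closed C & K = C `&` A.

(* psi is a local parametrization of K around p: an immersion of an open
   subset of R^k that is a homeomorphism, of inverse phi, onto a neighbourhood
   of p in K.  With E = 'M[R]_d and K `<=` spd this is the same as being an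
   embedded submanifold of spd, which is itself open in a linear subspace of E:
   the conditions only involve the topology induced on K and psi into K. *)
Definition embedded_submanifold (E : normedModType R) (K : set E) :=
  exists k : nat, forall p, K p ->
  exists (V : set E) (W : set 'rV[R]_k) (psi : 'rV[R]_k -> E)
         (phi : E -> 'rV[R]_k),
  [/\ [/\ open V, V p, open W & psi @` W = K `&` V],
      smooth_on W psi,
      (forall x, W x -> injective ('d psi x)),
      (forall x, W x -> phi (psi x) = x)
    & {within K `&` V, continuous phi}].

Definition tangent (E : normedModType R) (K : set E) (p v : E) :=
  exists (e : R) (c : R -> E),
  [/\ 0 < e, smooth_on [set` `]- e, e[] c, (forall t, t \in `]- e, e[ -> K (c t)),
      c 0 = p & derive1 c 0 = v].

End Submanifolds.

Section AffineInvariantGeodesics.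
Context {R : realType} {d : nat}.
Implicit Types (S X Y Z : 'M[R]_d).

(* Christoffel symbols of the first kind of the metric in the global chart of
   the positive-definite cone, an open subset of the symmetric matrices:
   ai_dot S (Gamma_S(X, Y)) Z, where nabla_X Y = D_X Y + Gamma(X, Y). *)
Definition ai_christoffel S X Y Z : R :=
  2^-1 * ('D_X (fun T : 'M[R]_d => ai_dot T Y Z) S
        + 'D_Y (fun T : 'M[R]_d => ai_dot T X Z) S
        - 'D_Z (fun T : 'M[R]_d => ai_dot T X Y) S).

(* The geodesic equation nabla_{c'} c' = 0, tested against every tangent
   vector Z. *)
Definition ai_geodesic (a b : R) (c : R -> 'M[R]_d) :=
  [/\ smooth_on [set` `]a, b[] c, (forall t, t \in `]a, b[ -> spd (c t))
    & forall t, t \in `]a, b[ -> forall Z, Z \is symmetricmx ->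
        ai_dot (c t) (derive1n 2 c t) Z
        + ai_christoffel (c t) (derive1 c t) (derive1 c t) Z = 0].

Definition ai_totally_geodesic (K : set 'M[R]_d) :=
  forall (a b t0 : R) (c : R -> 'M[R]_d),
    t0 \in `]a, b[ -> ai_geodesic a b c ->
    K (c t0) -> tangent K (c t0) (derive1 c t0) ->
    \forall t \near t0, K (c t).

End AffineInvariantGeodesics.

Section Kronecker.
Context {R : realType} (m n : nat).

(* tensmx B A (notation B *t A) is the matrix of n x n blocks B p q *: A, and
   mxtens_index (p, i) is the i-th index of the p-th block. *)
Definition kronecker_family : set 'M[R]_(n * m) :=
  [set G | exists (A : 'M[R]_m) (B : 'M[R]_n),
             [/\ spd A, spd B & G = tensmx B A]].

Definition mxblk (L : 'M[R]_(n * m)) (p q : 'I_n) : 'M[R]_m :=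
  \matrix_(i, j) L (mxtens_index (p, i)) (mxtens_index (q, j)).

Lemma mxblk_tens (A : 'M[R]_m) (B : 'M[R]_n) p q :
  mxblk (tensmx B A) p q = B p q *: A.
Proof. by apply/matrixP => i j; rewrite !mxE !mxtens_indexK. Qed.

Definition ptraceB (L : 'M[R]_(n * m)) : 'M[R]_m := \sum_(p < n) mxblk L p p.
Definition ptraceA (L : 'M[R]_(n * m)) : 'M[R]_n :=
  \matrix_(p, q) \tr (mxblk L p q).

End Kronecker.

Arguments kronecker_family : clear implicits.

(* Main.v *)
From HB Require Import structures.
Require Import Defs.
From mathcomp Require Import all_boot all_order all_algebra.
From mathcomp Require Import all_classical all_reals all_analysis.
From mathcomp Require Import complex.
From mathcomp Require Import ring lra.
Import Order.TTheory GRing.Theory Num.Theory.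
Import numFieldNormedType.Exports.

Set Implicit Arguments.
Unset Strict Implicit.
Unset Printing Implicit Defensive.

Local Open Scope classical_set_scope.
Local Open Scope ring_scope.

(** Why the theorem holds.

    The proof never integrates along paths; it rests on a comparison inequality
    between the affine-invariant distance and the Frobenius norm of logarithms,

      [frob_norm (mxlog T - mxlog S) <= ai_dist S T],

    which is [frob_mxlogB_le_ai_dist] and expresses nonpositive curvature.  In a
    pair of orthonormal eigenbases of [S] and [T], with eigenvalues [a_i], [b_j]
    and transition matrix [W], the scalar inequality
    [(ln b - ln a)^2 <= b / a + a / b - 2] gives
    [|log T - log S|^2 <= tr (S^-1 T) + tr (T^-1 S) - 2 d].  The right-hand side
    equals the squared distance up to terms of fourth order; cutting the
    geodesic from [S] to [T] into [N] equal pieces, adding the inequalities and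
    letting [N] grow removes the error.  The same inequality also shows that the
    logarithm is continuous.

    Transported by a congruence, the comparison says that
    [ai_dist M H >= |R - X|], where [R] and [X] are the logarithms of [M] and [H]
    seen from a base point [G].  For [G] and [H] in the Kronecker family [K],
    the logarithm [X] has the form [Y *t 1 + 1 *t Z], and the partial traces of
    [R] are exactly the obstructions to [R] being orthogonal to all such [X].
    When they vanish, [ai_dist M H ^ 2 >= ai_dist M G ^ 2 + |X| ^ 2]: the point
    [G] is the unique minimizer ([ptrace0_ai_proj]).  Conversely a minimizer has
    vanishing partial traces: applying the comparison at the points
    [exp (t X)] of a geodesic of [K] issued from it bounds the inner products of
    [X] with the logarithms of [M] at these points, and [t -> 0] gives
    [<R, X> <= 0] ([ai_proj_slope]); then [X] is taken to be a partial trace of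
    [R] itself.  A minimizer exists because, in logarithmic coordinates at [M],
    the distance to [M] is a norm and [K] is cut out by polynomial equations
    ([ai_proj_exists]).

    These equations, quadratic in the entries, say that [G] has tensor rank one.
    Normalizing one entry of the factor [B] to [1] gives a single polynomial
    chart whose inverse is rational, hence an embedded submanifold.

    Finally the Christoffel symbols turn the geodesic equation into
    [c'' = c' c^-1 c'], that is, [c^-1 c'] is constant, equal to some [X].  If
    [c] is tangent to [K] at a point of [K], then [X = Y *t 1 + 1 *t Z], and the
    Kronecker product of the geodesics with data [Y] and [Z] solves the same
    linear equation [g' = g X]; so [c g^-1] is constant and [c] stays in [K]. *)

(** * Symmetric matrices and their spectral theorem *)

Lemma symmetricmxP (R : realType) d (S : 'M[R]_d) :
  S \is symmetricmx <-> S^T = S.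
Proof.
split=> [/is_hermitianmxP|h]; last apply/is_hermitianmxP.
  by rewrite expr0 scale1r map_mx_id.
by rewrite expr0 scale1r map_mx_id.
Qed.

Lemma mxaddE (R : nmodType) m n (A B : 'M[R]_(m, n)) i j :
  (A + B) i j = A i j + B i j.
Proof. by rewrite mxE. Qed.

Lemma mxoppE (R : zmodType) m n (A : 'M[R]_(m, n)) i j : (- A) i j = - A i j.
Proof. by rewrite mxE. Qed.

Lemma mxscaleE (R : pzRingType) m n a (A : 'M[R]_(m, n)) i j :
  (a *: A) i j = a * A i j.
Proof. by rewrite mxE. Qed.

Section Spectral.
Variable R : realType.

Lemma mulmx_tr_ge0 n (x : 'rV[R]_n) : 0 <= (x *m x^T) 0 0.
Proof. by rewrite mxE; apply: sumr_ge0 => i _; rewrite !mxE -expr2 sqr_ge0. Qed.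

Lemma mulmx_tr_eq0 n (x : 'rV[R]_n) : ((x *m x^T) 0 0 == 0) = (x == 0).
Proof.
apply/eqP/eqP => [|->]; last by rewrite mul0mx mxE.
rewrite mxE => /eqP; rewrite psumr_eq0 => [/allP h|i _]; last first.
  by rewrite !mxE -expr2 sqr_ge0.
apply/rowP => j; have := h j (mem_index_enum j).
by rewrite !mxE -expr2 sqrf_eq0 => /eqP.
Qed.

Lemma mulmx_trC n (u v : 'rV[R]_n) : u *m v^T = v *m u^T.
Proof.
by apply/matrixP => i j; rewrite !ord1 !mxE; apply: eq_bigr => k _;
  rewrite !mxE mulrC.
Qed.

(** A complex eigenvalue of a real symmetric matrix is real, so the real or the
    imaginary part of a complex eigenvector is a real eigenvector. *)
Lemma symmetric_eigenvector n (A : 'M[R]_n.+1) : A^T = A ->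
  exists a, exists2 v : 'rV[R]_n.+1, v != 0 & v *m A = a *: v.
Proof.
move=> symA.
have [a /eigenvalueP[v vA v0]] :=
  eigenvalue_closed (map_mx (real_complex R) A) (ltn0Sn n).
pose x : 'rV[R]_n.+1 := map_mx (@complex.Re R) v.
pose y : 'rV[R]_n.+1 := map_mx (@complex.Im R) v.
have ReD (z w : R[i]) : complex.Re (z + w) = complex.Re z + complex.Re w
  by case: z w => ? ? [].
have ImD (z w : R[i]) : complex.Im (z + w) = complex.Im z + complex.Im w
  by case: z w => ? ? [].
have xA : x *m A = complex.Re a *: x - complex.Im a *: y.
  apply/rowP => j; have /(congr1 (fun w : 'rV[R[i]]_n.+1 => complex.Re (w 0 j)))
    := vA.
  rewrite !mxE (big_morph _ ReD (erefl : complex.Re 0 = 0)).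
  case: a {vA} => a b; case: (v 0 j) => p q /= <-.
  by apply: eq_bigr => k _; rewrite !mxE; case: (v 0 k) => r s /=;
    rewrite mulr0 subr0.
have yA : y *m A = complex.Im a *: x + complex.Re a *: y.
  apply/rowP => j; have /(congr1 (fun w : 'rV[R[i]]_n.+1 => complex.Im (w 0 j)))
    := vA.
  rewrite !mxE (big_morph _ ImD (erefl : complex.Im 0 = 0)).
  case: a {vA xA} => a b; case: (v 0 j) => p q /=; rewrite addrC => <-.
  by apply: eq_bigr => k _; rewrite !mxE; case: (v 0 k) => r s /=;
    rewrite mulr0 add0r.
have xy0 : (x != 0) || (y != 0).
  apply: contraNT v0; rewrite negb_or !negbK => /andP[/eqP x0 /eqP y0].
  apply/eqP/rowP => j; have /rowP/(_ j) := x0; have /rowP/(_ j) := y0.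
  by rewrite !mxE; case: (v 0 j) => p q /= -> ->.
(* Symmetry of the two mixed products forces the imaginary part of [a] to be 0. *)
have sw : x *m A *m y^T = y *m A *m x^T.
  by rewrite mulmx_trC trmx_mul symA mulmxA.
have ima : complex.Im a = 0.
  move: sw; rewrite xA yA mulmxBl mulmxDl -!scalemxAl.
  rewrite (mulmx_trC y).
  move=> /matrixP/(_ 0 0); rewrite !(mxaddE, mxoppE, mxscaleE).
  move: (mulmx_tr_eq0 x) (mulmx_tr_eq0 y) (mulmx_tr_ge0 x) (mulmx_tr_ge0 y).
  move: ((x *m x^T) 0 0) ((y *m y^T) 0 0) => X Y eX eY X0 Y0 e.
  have : complex.Im a * (X + Y) = 0 by rewrite mulrDr; lra.
  move=> /eqP; rewrite mulf_eq0 => /orP[/eqP //|].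
  by rewrite paddr_eq0// eX eY; move: xy0; case: (x == 0); case: (y == 0).
exists (complex.Re a); case/orP: xy0 => h; [exists x|exists y] => //.
  by rewrite xA ima scale0r subr0.
by rewrite yA ima scale0r add0r.
Qed.

(** The Householder reflection along [v - e_0] exchanges [v] with the first
    basis vector [e_0]. *)
Lemma orthogonal_extend n (v : 'rV[R]_n.+1) : v *m v^T = 1%:M ->
  exists2 H : 'M[R]_n.+1, H^T *m H = 1%:M & delta_mx 0 0 *m H = v.
Proof.
move=> v1; pose e : 'rV[R]_n.+1 := delta_mx 0 0.
have e1 : e *m e^T = 1%:M.
  by rewrite /e trmx_delta mul_delta_mx; apply/matrixP => i j;
    rewrite !ord1 !mxE.
have [->|ve] := eqVneq v e.
  by exists 1%:M; rewrite ?mulmx1 ?trmx1.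
have [w wE] : exists w, w = v - e by eexists.
pose c := (w *m w^T) 0 0.
have c0 : c != 0 by rewrite mulmx_tr_eq0 wE subr_eq0.
have wwE : w *m w^T = c%:M by apply/matrixP => i j; rewrite !ord1 [RHS]mxE.
pose H := 1%:M - (2 / c) *: (w^T *m w).
have HT : H^T = H.
  by rewrite /H linearB linearZ /= trmx1 trmx_mul trmxK.
exists H.
  rewrite HT /H mulmxBl mul1mx mulmxBr mulmx1 -scalemxAl -scalemxAr.
  rewrite -!mulmxA (mulmxA w) wwE mul_scalar_mx -scalemxAr !scalerA.
  rewrite divfK// opprB -addrA -[RHS]addr0; congr (_ + _).
  rewrite -scaleNr -!scalerDl; set k := (X in X *: _).
  have -> : k = 0 by rewrite /k; ring.
  by rewrite scale0r.
have ew : c = - 2 * (e *m w^T) 0 0.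
  rewrite /c wE linearB /= mulmxBl !mulmxBr v1 e1.
  rewrite (mulmx_trC v) !(mxaddE, mxoppE) [1%:M _ _]mxE /=; ring.
rewrite -/e /H mulmxBr mulmx1 -scalemxAr mulmxA.
have -> : e *m w^T = (- c / 2)%:M.
  by apply/matrixP => i j; rewrite !ord1 [RHS]mxE ew mulr1n; field.
rewrite mul_scalar_mx scalerA.
have -> : 2 / c * (- c / 2) = -1 by field.
by rewrite scaleN1r opprK wE addrC subrK.
Qed.

(** Deflation: in an orthonormal frame starting with a unit eigenvector, symmetry
    makes the matrix block diagonal with blocks of sizes [1] and [n]. *)
Theorem symmetric_spectral n (A : 'M[R]_n) : A^T = A ->
  exists U : 'M[R]_n, exists2 s : 'rV[R]_n,
    U^T *m U = 1%:M & A = U^T *m diag_mx s *m U.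
Proof.
elim: n A => [|n IH] A symA.
  by exists 1%:M, 0; rewrite ?trmx1 ?mulmx1//; apply/matrixP => -[].
have [a [v0 v0n0 v0A]] := symmetric_eigenvector symA.
pose v := (Num.sqrt ((v0 *m v0^T) 0 0))^-1 *: v0.
have vA : v *m A = a *: v by rewrite /v -scalemxAl v0A !scalerA mulrC.
have v1 : v *m v^T = 1%:M.
  rewrite /v linearZ /= -scalemxAl -scalemxAr scalerA.
  apply/matrixP => i j; rewrite !ord1 !mxE /= -expr2 exprVn sqr_sqrtr.
    by have := mulmx_tr_eq0 v0; rewrite (negPf v0n0) mxE => /negbT h;
      rewrite mulVf.
  by have := mulmx_tr_ge0 v0; rewrite mxE.
have [H HH eH] := orthogonal_extend v1.
have HH' : H *m H^T = 1%:M by apply: mulmx1C.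
have [B BE] : exists B : 'M[R]_(1 + n), B = H *m A *m H^T by eexists.
have symB : B^T = B by rewrite BE !trmx_mul trmxK symA mulmxA.
have B0 : row 0 B = a *: delta_mx 0 0.
  by rewrite rowE BE !mulmxA eH vA -scalemxAl -eH -mulmxA HH' mulmx1.
have l0 : lshift n 0 = 0 :> 'I_(1 + n) by apply: val_inj.
have Bul : ulsubmx B = a%:M.
  apply/matrixP => i j; have /rowP/(_ (lshift n j)) := B0.
  by rewrite !ord1 l0 !mxE /= l0 mulr1n mulr1.
have Bur : ursubmx B = 0.
  apply/matrixP => i j; have /rowP/(_ (rshift 1 j)) := B0.
  by rewrite !ord1 !mxE /= l0 mulr0.
have Bdl : dlsubmx B = 0.
  by rewrite -symB -trmx_ursub Bur trmx0.
have symD : (drsubmx B)^T = drsubmx B by rewrite trmx_drsub symB.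
have [U [s UU DE]] := IH _ symD.
pose V : 'M[R]_(1 + n) := block_mx 1%:M 0 0 U.
have VV : V^T *m V = 1%:M.
  rewrite /V tr_block_mx mulmx_block
    !(trmx0, trmx1, mul0mx, mulmx0, addr0, add0r, mulmx1).
  by rewrite UU -scalar_mx_block.
exists (V *m H), (row_mx a%:M s).
  by rewrite trmx_mul !mulmxA -(mulmxA H^T) VV mulmx1.
have BV : B = V^T *m diag_mx (row_mx a%:M s) *m V.
  rewrite -[B]submxK Bul Bur Bdl DE /V tr_block_mx diag_mx_row.
  rewrite !mulmx_block
    !(trmx0, trmx1, mul0mx, mulmx0, addr0, add0r, mulmx1, mul1mx).
  by congr block_mx; apply/matrixP => i j; rewrite !ord1 !mxE /=.
have -> : (V *m H)^T *m diag_mx (row_mx a%:M s) *m (V *m H) = H^T *m B *m H.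
  by rewrite BV trmx_mul !mulmxA.
by rewrite BE !mulmxA HH mul1mx -mulmxA HH mulmx1.
Qed.

End Spectral.

(** * Functional calculus and positive-definite matrices *)

Section FunctionalCalculus.
Context {R : realType} {d : nat}.
Implicit Types (S T U V O : 'M[R]_d) (s : 'rV[R]_d) (f g : R -> R).

Lemma orthogonal_diagM U s t : U^T *m U = 1%:M ->
  (U^T *m diag_mx s *m U) *m (U^T *m diag_mx t *m U) =
  U^T *m diag_mx (\row_i (s 0 i * t 0 i)) *m U.
Proof.
move=> /mulmx1C UU; rewrite -!mulmxA (mulmxA U) UU mul1mx (mulmxA (diag_mx s)).
by rewrite mulmx_diag.
Qed.

Lemma mxfun_trmx f S : S^T = S -> (mxfun f S)^T = mxfun f S.
Proof.
move=> /symmetric_spectral[U [s UU SE]].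
by rewrite (mxfunE f UU SE) !trmx_mul tr_diag_mx trmxK mulmxA.
Qed.

Lemma mxfun_conj f S O : S^T = S -> O^T *m O = 1%:M ->
  mxfun f (O^T *m S *m O) = O^T *m mxfun f S *m O.
Proof.
move=> /symmetric_spectral[U [s UU SE]] OO.
have UO : (U *m O)^T *m (U *m O) = 1%:M.
  by rewrite trmx_mul mulmxA -(mulmxA O^T) UU mulmx1.
rewrite (mxfunE f UU SE) (mxfunE (s := s) f UO) ?SE; rewrite trmx_mul !mulmxA//.
Qed.

Lemma mxfunM f g S : S^T = S ->
  mxfun f S *m mxfun g S = mxfun (fun x => f x * g x) S.
Proof.
move=> /symmetric_spectral[U [s UU SE]].
rewrite !(mxfunE _ UU SE) orthogonal_diagM//; congr (_ *m diag_mx _ *m _).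
by apply/rowP => i; rewrite !mxE.
Qed.

Lemma mxfun_comp f g S : S^T = S ->
  mxfun f (mxfun g S) = mxfun (fun x => f (g x)) S.
Proof.
move=> /symmetric_spectral[U [s UU SE]].
rewrite [mxfun g S](mxfunE _ UU SE) [RHS](mxfunE _ UU SE) (mxfunE _ UU erefl).
by congr (_ *m diag_mx _ *m _); apply/rowP => i; rewrite !mxE.
Qed.

Lemma mxfun1 S : S^T = S -> mxfun (fun=> 1) S = 1%:M.
Proof.
move=> /symmetric_spectral[U [s UU SE]]; rewrite (mxfunE _ UU SE).
have -> : map_mx (fun=> 1 : R) s = const_mx 1 by apply/rowP => i; rewrite !mxE.
by rewrite diag_const_mx mulmx1.
Qed.

Lemma mxfun_id S : S^T = S -> mxfun id S = S.
Proof.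
move=> /symmetric_spectral[U [s UU SE]]; rewrite (mxfunE _ UU SE) [RHS]SE.
by congr (_ *m diag_mx _ *m _); apply/rowP => i; rewrite !mxE.
Qed.

Lemma quad_diagE s (x : 'cV[R]_d) :
  (x^T *m diag_mx s *m x) 0 0 = \sum_i s 0 i * x i 0 ^+ 2.
Proof.
by rewrite mul_mx_diag !mxE; apply: eq_bigr => i _; rewrite !mxE; ring.
Qed.

Lemma spd_sym S : spd S -> S^T = S.
Proof. by case=> /symmetricmxP. Qed.

Lemma spd_diag U s : U^T *m U = 1%:M ->
  spd (U^T *m diag_mx s *m U) <-> forall i, 0 < s 0 i.
Proof.
move=> UU; have UU' := mulmx1C UU; split=> [[_ h] i|s0].
  have := h (U^T *m delta_mx i 0); rewrite trmx_mul trmxK !mulmxA.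
  rewrite -(mulmxA _ U) UU' mulmx1 -(mulmxA _ U) UU' mulmx1 quad_diagE.
  rewrite (bigD1 i)//= big1 ?addr0 => [|j /negPf ji]; last first.
    by rewrite !mxE ji/= expr0n mulr0.
  rewrite !mxE !eqxx expr1n mulr1; apply; apply/eqP => /(congr1 (mulmx U)).
  rewrite mulmxA UU' mul1mx mulmx0 => /matrixP/(_ i 0); rewrite !mxE !eqxx.
  by apply/eqP; rewrite oner_eq0.
split=> [|x x0].
  by apply/symmetricmxP; rewrite !trmx_mul tr_diag_mx trmxK mulmxA.
rewrite !mulmxA -(trmxK U) -trmx_mul trmxK -mulmxA quad_diagE.
have nn i : 0 <= s 0 i * (U *m x) i 0 ^+ 2 by rewrite mulr_ge0 ?sqr_ge0 ?ltW.
rewrite lt0r sumr_ge0 // andbT; apply: contra_neq x0 => e0.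
have Ux : U *m x = 0.
  apply/colP => i; have /eqP :=
    @psumr_eq0P _ _ xpredT _ (fun i _ => nn i) e0 i isT.
  by rewrite [RHS]mxE mulf_eq0 (gt_eqF (s0 i)) sqrf_eq0 => /eqP.
by rewrite -[x]mul1mx -UU -mulmxA Ux mulmx0.
Qed.

Lemma spd_spectral S : spd S -> exists U, exists2 s,
  [/\ U^T *m U = 1%:M & S = U^T *m diag_mx s *m U] & forall i, 0 < s 0 i.
Proof.
move=> sS; have [U [s UU SE]] := symmetric_spectral (spd_sym sS).
by exists U, s => //; apply/(spd_diag _ UU); rewrite -SE.
Qed.

Lemma spd_mxfun_pos f S : S^T = S -> (forall x, 0 < f x) -> spd (mxfun f S).
Proof.
move=> /symmetric_spectral[U [s UU SE]] f0.
by rewrite (mxfunE _ UU SE); apply/spd_diag => // i; rewrite mxE.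
Qed.

Lemma spd_mxfun f S : spd S -> (forall x, 0 < x -> 0 < f x) -> spd (mxfun f S).
Proof.
move=> /spd_spectral[U [s [UU SE] s0]] f0.
by rewrite (mxfunE _ UU SE); apply/spd_diag => // i; rewrite mxE; apply: f0.
Qed.

Lemma eq_mxfun f g S : S^T = S -> f =1 g -> mxfun f S = mxfun g S.
Proof.
move=> /symmetric_spectral[U [s UU SE]] fg; rewrite !(mxfunE _ UU SE).
by congr (_ *m diag_mx _ *m _); apply/rowP => i; rewrite !mxE.
Qed.

Lemma eq_spd_mxfun f g S : spd S -> (forall x, 0 < x -> f x = g x) ->
  mxfun f S = mxfun g S.
Proof.
move=> /spd_spectral[U [s [UU SE] s0]] fg; rewrite !(mxfunE _ UU SE).
by congr (_ *m diag_mx _ *m _); apply/rowP => i; rewrite !mxE fg.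
Qed.

Lemma spd_unit S : spd S -> S \in unitmx.
Proof.
move=> sS; have S1 : mxfun (fun x => x^-1) S *m S = 1%:M.
  rewrite -{2}(mxfun_id (spd_sym sS)) mxfunM ?spd_sym// -(mxfun1 (spd_sym sS)).
  by apply: eq_spd_mxfun => // x x0; rewrite mulVf ?gt_eqF.
by case/mulmx1_unit: S1.
Qed.

Lemma spd1 : spd (1%:M : 'M[R]_d).
Proof.
rewrite -[1%:M](mxfun1 (trmx1 _ _)); apply: spd_mxfun_pos => [|_];
  first exact: trmx1.
exact: ltr01.
Qed.

Lemma spd_congr S (C : 'M[R]_d) : spd S -> C \in unitmx -> spd (C^T *m S *m C).
Proof.
move=> [/symmetricmxP symS h] uC; split=> [|x x0].
  by apply/symmetricmxP; rewrite !trmx_mul trmxK symS mulmxA.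
rewrite !mulmxA -trmx_mul -(mulmxA _ C); apply: h.
by apply: contra_neq x0 => /(congr1 (mulmx (invmx C))); rewrite mulKmx// mulmx0.
Qed.

Lemma invmx_mxfun S : spd S -> invmx S = mxfun (fun x => x^-1) S.
Proof.
move=> sS; apply: (can_inj (mulKmx (spd_unit sS))).
rewrite mulmxV ?spd_unit// -{1}(mxfun_id (spd_sym sS)) mxfunM ?spd_sym//.
rewrite -(mxfun1 (spd_sym sS)).
by apply: eq_spd_mxfun => // x x0; rewrite mulfV ?gt_eqF.
Qed.

Lemma spd_invmx S : spd S -> spd (invmx S).
Proof.
move=> sS; rewrite invmx_mxfun//; apply: spd_mxfun => // x.
by rewrite invr_gt0.
Qed.

Lemma spd_mxsqrt S : spd S -> spd (mxsqrt S).
Proof. by move=> sS; rewrite /mxsqrt; apply: spd_mxfun => // x x0;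
  rewrite sqrtr_gt0. Qed.

Lemma mxsqrtK S : spd S -> mxsqrt S *m mxsqrt S = S.
Proof.
move=> sS; rewrite /mxsqrt mxfunM ?spd_sym// -[RHS](mxfun_id (spd_sym sS)).
by apply: eq_spd_mxfun => // x x0; rewrite -expr2 sqr_sqrtr// ltW.
Qed.

Lemma spd_mxinvsqrt S : spd S -> spd (mxinvsqrt S).
Proof. by move=> sS; apply/spd_invmx/spd_mxsqrt. Qed.

Lemma mxinvsqrt_trmx S : spd S -> (mxinvsqrt S)^T = mxinvsqrt S.
Proof. by move=> /spd_mxinvsqrt/spd_sym. Qed.

Lemma mxinvsqrt_unit S : spd S -> mxinvsqrt S \in unitmx.
Proof. by move=> /spd_mxinvsqrt/spd_unit. Qed.

Lemma mxsqrt_unit S : spd S -> mxsqrt S \in unitmx.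
Proof. by move=> /spd_mxsqrt/spd_unit. Qed.

Lemma mxinvsqrtK S : spd S -> mxinvsqrt S *m mxinvsqrt S = invmx S.
Proof.
move=> sS; have u := mxsqrt_unit sS; rewrite -[in RHS](mxsqrtK sS).
apply: (can_inj (mulKmx u)); rewrite mulKVmx//.
apply: (can_inj (mulKmx u)); rewrite mulmxV// mulmxA mulmxV// unitmx_mul.
by rewrite u.
Qed.

Lemma whiten_spd S T : spd S -> spd T -> spd (whiten S T).
Proof.
move=> sS sT; rewrite /whiten -{1}(mxinvsqrt_trmx sS).
exact/spd_congr/mxinvsqrt_unit.
Qed.

Lemma whiten_id S : spd S -> whiten S S = 1%:M.
Proof.
move=> sS; rewrite /whiten -{2}(mxsqrtK sS) mulmxA mulVmx ?mxsqrt_unit// mul1mx.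
by rewrite mulmxV ?mxsqrt_unit.
Qed.

Lemma whitenK S T : spd S -> mxsqrt S *m whiten S T *m mxsqrt S = T.
Proof.
move=> sS; rewrite /whiten !mulmxA mulmxV ?mxsqrt_unit// mul1mx.
by rewrite -mulmxA mulVmx ?mxsqrt_unit// mulmx1.
Qed.

Definition mxexp S := mxfun expR S.

Lemma mxexpZ t S : S^T = S -> mxexp (t *: S) = mxfun (fun x => expR (t * x)) S.
Proof.
move=> /symmetric_spectral[U [s UU SE]].
have tSE : t *: S = U^T *m diag_mx (t *: s) *m U.
  by rewrite linearZ /= -scalemxAr -scalemxAl -SE.
rewrite /mxexp (mxfunE _ UU tSE) (mxfunE _ UU SE).
by congr (_ *m diag_mx _ *m _); apply/rowP => i; rewrite !mxE.
Qed.

Lemma mxexp_spd S : S^T = S -> spd (mxexp S).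
Proof. by move=> symS; apply: spd_mxfun_pos => // x; apply: expR_gt0. Qed.

Lemma mxlogK S : spd S -> mxexp (mxlog S) = S.
Proof.
move=> sS; rewrite /mxexp mxfun_comp ?spd_sym// -[RHS](mxfun_id (spd_sym sS)).
by apply: eq_spd_mxfun => // x x0; rewrite lnK.
Qed.

Lemma mxexpK S : S^T = S -> mxlog (mxexp S) = S.
Proof.
move=> sS; rewrite /mxlog mxfun_comp// -[RHS](mxfun_id sS).
by apply: eq_mxfun => // x; rewrite expRK.
Qed.

Lemma mxlog_trmx S : spd S -> (mxlog S)^T = mxlog S.
Proof. by move=> sS; apply/mxfun_trmx/spd_sym. Qed.

Lemma mxlog_invmx S : spd S -> mxlog (invmx S) = - mxlog S.
Proof.
move=> sS; rewrite invmx_mxfun// /mxlog mxfun_comp ?spd_sym//.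
have [U [s [UU SE] s0]] := spd_spectral sS.
rewrite !(mxfunE _ UU SE) -mulNmx -mulmxN; congr (_ *m _ *m _).
apply/matrixP => i j; rewrite !mxE lnV ?posrE//.
by rewrite mulNrn.
Qed.

End FunctionalCalculus.

(** * The Frobenius inner product *)

Section Frobenius.
Context {R : realType}.

Lemma frob_dotE d (X Y : 'M[R]_d) : frob_dot X Y = \sum_i \sum_j X i j * Y i j.
Proof.
rewrite /frob_dot /mxtrace exchange_big /=; apply: eq_bigr => i _.
by rewrite mxE; apply: eq_bigr => j _; rewrite mxE.
Qed.

Lemma frob_dotC d (X Y : 'M[R]_d) : frob_dot X Y = frob_dot Y X.
Proof. by rewrite /frob_dot -mxtrace_tr trmx_mul trmxK. Qed.

Lemma frob_dot_ge0 d (X : 'M[R]_d) : 0 <= frob_dot X X.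
Proof.
by rewrite frob_dotE; do 2!apply: sumr_ge0 => ? _; rewrite -expr2 sqr_ge0.
Qed.

Lemma frob_dot_eq0 d (X : 'M[R]_d) : frob_dot X X = 0 -> X = 0.
Proof.
rewrite frob_dotE => /eqP; rewrite psumr_eq0 => [/allP h|i _]; last first.
  by apply: sumr_ge0 => ? _; rewrite -expr2 sqr_ge0.
apply/matrixP => i j; have := h i (mem_index_enum i).
rewrite psumr_eq0 => [/allP /(_ j (mem_index_enum j))|k _]; last first.
  by rewrite -expr2 sqr_ge0.
by rewrite -expr2 sqrf_eq0 mxE => /eqP.
Qed.

Lemma frob_normK d (X : 'M[R]_d) : frob_norm X ^+ 2 = frob_dot X X.
Proof. by rewrite sqr_sqrtr// frob_dot_ge0. Qed.

Lemma frob_norm_ge0 d (X : 'M[R]_d) : 0 <= frob_norm X.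
Proof. exact: sqrtr_ge0. Qed.

Lemma frob_norm_le d (X Y : 'M[R]_d) :
  (frob_norm X <= frob_norm Y) = (frob_dot X X <= frob_dot Y Y).
Proof. by rewrite ler_sqrt// frob_dot_ge0. Qed.

Lemma frob_dotDl d (X Y Z : 'M[R]_d) :
  frob_dot (X + Y) Z = frob_dot X Z + frob_dot Y Z.
Proof. by rewrite /frob_dot linearD /= mulmxDl mxtraceD. Qed.

Lemma frob_dotDr d (X Y Z : 'M[R]_d) :
  frob_dot Z (X + Y) = frob_dot Z X + frob_dot Z Y.
Proof. by rewrite /frob_dot mulmxDr mxtraceD. Qed.

Lemma frob_dotZl d a (X Z : 'M[R]_d) : frob_dot (a *: X) Z = a * frob_dot X Z.
Proof. by rewrite /frob_dot linearZ /= -scalemxAl mxtraceZ. Qed.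

Lemma frob_dotZr d a (X Z : 'M[R]_d) : frob_dot Z (a *: X) = a * frob_dot Z X.
Proof. by rewrite /frob_dot -scalemxAr mxtraceZ. Qed.

Lemma frob_dotNl d (X Z : 'M[R]_d) : frob_dot (- X) Z = - frob_dot X Z.
Proof. by rewrite -scaleN1r frob_dotZl mulN1r. Qed.

Lemma frob_dotNr d (X Z : 'M[R]_d) : frob_dot Z (- X) = - frob_dot Z X.
Proof. by rewrite -scaleN1r frob_dotZr mulN1r. Qed.

Lemma frob_normN d (X : 'M[R]_d) : frob_norm (- X) = frob_norm X.
Proof. by rewrite /frob_norm frob_dotNl frob_dotNr opprK. Qed.

Lemma frob_dot_orth d (U V X Y : 'M[R]_d) : U^T *m U = 1%:M -> V^T *m V =
  1%:M ->
  frob_dot (U *m X *m V^T) (U *m Y *m V^T) = frob_dot X Y.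
Proof.
move=> UU VV; rewrite /frob_dot !trmx_mul trmxK !mulmxA.
by rewrite -(mulmxA _ U^T) UU mulmx1 mxtrace_mulC !mulmxA VV mul1mx.
Qed.

Lemma frob_norm_orth d (O X : 'M[R]_d) : O^T *m O = 1%:M ->
  frob_norm (O^T *m X *m O) = frob_norm X.
Proof.
move=> OO; rewrite /frob_norm; congr Num.sqrt.
have OO' : O^T^T *m O^T = 1%:M by rewrite trmxK; apply: mulmx1C.
by have := frob_dot_orth X X OO' OO'; rewrite trmxK.
Qed.

Lemma frob_diag d (U : 'M[R]_d) (s : 'rV[R]_d) : U^T *m U = 1%:M ->
  frob_dot (U^T *m diag_mx s *m U) (U^T *m diag_mx s *m U) = \sum_i s 0 i ^+ 2.
Proof.
move=> UU; have UU' : U^T^T *m U^T = 1%:M by rewrite trmxK; apply: mulmx1C.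
have := frob_dot_orth (diag_mx s) (diag_mx s) UU' UU'; rewrite trmxK => ->.
rewrite /frob_dot tr_diag_mx mulmx_diag /mxtrace; apply: eq_bigr => i _.
by rewrite !mxE eqxx mulr1n expr2.
Qed.

End Frobenius.

(** * The affine-invariant distance *)

Section AffineInvariantDistance.
Context {R : realType} {d : nat}.
Implicit Types (S T C : 'M[R]_d).

(** Two congruences taking [S] to the identity differ by an orthogonal factor,
    which commutes with the logarithm and is invisible to the Frobenius norm.
    All the invariances of the distance follow. *)
Lemma ai_distE S T C : spd S -> spd T -> C^T *m S *m C = 1%:M ->
  ai_dist S T = frob_norm (mxlog (C^T *m T *m C)).
Proof.
move=> sS sT CS; pose O := mxsqrt S *m C; pose P := mxinvsqrt S.
have symq : (mxsqrt S)^T = mxsqrt S by apply/spd_sym/spd_mxsqrt.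
have OO : O^T *m O = 1%:M.
  by rewrite /O trmx_mul symq mulmxA -(mulmxA C^T) mxsqrtK.
have CE : C = P *m O by rewrite /P /O mulKmx ?mxsqrt_unit.
have -> : C^T *m T *m C = O^T *m whiten S T *m O.
  by rewrite CE trmx_mul mxinvsqrt_trmx// /whiten -/P !mulmxA.
rewrite /ai_dist /mxlog mxfun_conj ?frob_norm_orth//.
exact/spd_sym/whiten_spd.
Qed.

Lemma whiten_congr S T : spd S ->
  (mxinvsqrt S)^T *m T *m mxinvsqrt S = whiten S T.
Proof. by move=> sS; rewrite mxinvsqrt_trmx. Qed.

Lemma ai_dist_congr S T C : spd S -> spd T -> C \in unitmx ->
  ai_dist (C^T *m S *m C) (C^T *m T *m C) = ai_dist S T.
Proof.
move=> sS sT uC; have sS' := spd_congr sS uC.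
pose P := mxinvsqrt (C^T *m S *m C).
rewrite (@ai_distE S T (C *m P))//.
  rewrite /ai_dist -whiten_congr//; congr (frob_norm (mxlog _)).
  by rewrite trmx_mul !mulmxA.
by rewrite -(whiten_id sS') -(whiten_congr _ sS') /P trmx_mul !mulmxA.
Qed.

(** The congruence [S^(-1/2) W^(-1/2)], with [W = whiten S T], takes [T] to the
    identity and [S] to [W^-1], whose logarithm is the opposite of that of [W]. *)
Lemma ai_dist_sym S T : spd S -> spd T -> ai_dist S T = ai_dist T S.
Proof.
move=> sS sT; have sW := whiten_spd sS sT; pose W := whiten S T.
rewrite (@ai_distE T S (mxinvsqrt S *m mxinvsqrt W))//.
  rewrite trmx_mul !mxinvsqrt_trmx// -!mulmxA (mulmxA (mxinvsqrt S)).
  rewrite (mulmxA (mxinvsqrt S *m S)) -[_ *m S *m _]/(whiten S S) whiten_id//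
    mul1mx.
  by rewrite mxinvsqrtK// mxlog_invmx// frob_normN.
rewrite trmx_mul !mxinvsqrt_trmx//.
transitivity (mxinvsqrt W *m W *m mxinvsqrt W); last exact: whiten_id.
have WE : W = mxinvsqrt S *m T *m mxinvsqrt S by [].
by rewrite [X in _ = _ *m X *m _]WE !mulmxA.
Qed.

End AffineInvariantDistance.

(** * The logarithm contracts the affine-invariant distance *)

Section MetricIncreasing.
Context {R : realType}.

(** The derivative of the right-hand side is at least [2]. *)
Lemma sinh_ge (y : R) : 0 <= y -> 2 * y <= expR y - expR (- y).
Proof.
rewrite le_eqVlt => /predU1P[<-|y0]; first by rewrite oppr0 mulr0 subrr.
pose f : R -> R := expR - (expR \o -%R).
have df (t : R) : is_derive t 1 f (expR t + expR (- t)).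
  apply: is_derive_eq.
  by rewrite mulrN1 opprK.
have cf : {within `[0, y], continuous f}.
  by apply: derivable_within_continuous => t _; case: (df t).
have [c _] := MVT y0 (fun t _ => df t) cf.
have -> : f y - f 0 = expR y - expR (- y).
  by rewrite /f !fctE /= oppr0 subrr subr0.
rewrite subr0 => ->; rewrite ler_pM2r//.
have := expR_ge1Dx c; have := expR_ge1Dx (- c); lra.
Qed.

(** The right-hand side is the square of [2 sinh (x / 2)]. *)
Lemma sqr_le_coshB2 (x : R) : x ^+ 2 <= expR x + expR (- x) - 2.
Proof.
have e y : expR y + expR (- y) - 2 =
  (expR (y / 2) - expR (- (y / 2))) ^+ 2 :> R.
  rewrite {1}(splitr y) [in expR (- y)](splitr y) opprD !expRD.
  have : expR (y / 2) * expR (- (y / 2)) = 1 by rewrite -expRD subrr expR0.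
  move: (expR (y / 2)) (expR (- (y / 2))) => a b ab.
  by rewrite sqrrB -!expr2 ab; ring.
wlog x0 : x / 0 <= x.
  move=> h; have [/h//|/ltW] := leP 0 x; rewrite -oppr_ge0 => /h.
  by rewrite sqrrN opprK (addrC (expR (- x))).
have h : 0 <= x / 2 by lra.
have := sinh_ge h; rewrite e mulrC divfK// => h2.
by rewrite ler_sqr ?nnegrE// (le_trans x0).
Qed.

(** The error factor [expR `|x|] tends to [1] at [0]: the bound
    [sqr_le_coshB2] is sharp to second order, which is what makes the
    subdivision of geodesics work. *)
Lemma coshB2_le (x : R) : expR x + expR (- x) - 2 <= x ^+ 2 * expR `|x|.
Proof.
wlog x0 : x / 0 <= x.
  move=> h; have [/h//|/ltW] := leP 0 x; rewrite -oppr_ge0 => /h.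
  by rewrite sqrrN opprK normrN (addrC (expR (- x))).
rewrite ger0_norm//; set a := expR x; have a0 : 0 < a := expR_gt0 _.
have [b0 b1] : 0 < expR (- x) /\ 1 - x <= expR (- x).
  by split; [exact: expR_gt0|exact: expR_ge1Dx].
have ab : a * expR (- x) = 1 by rewrite -expRD subrr expR0.
have b2 : expR (- x) <= 1 by rewrite -expR0 ler_expR oppr_le0.
move: (expR (- x)) ab b0 b1 b2 => b ab b0 b1 b2.
have -> : a + b - 2 = a * (1 - b) ^+ 2.
  by rewrite sqrrB expr1n mul1r mulrDr mulrBr expr2 mulrA mulrnAr ab; ring.
rewrite mulrC ler_pM2r//; apply: lerXn2r; rewrite ?nnegrE//; lra.
Qed.

Lemma ln_dist_le (a b : R) : 0 < a -> 0 < b ->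
  (ln b - ln a) ^+ 2 <= b / a + a / b - 2.
Proof.
move=> a0 b0; have := sqr_le_coshB2 (ln b - ln a).
by rewrite opprB !expRD !expRN !lnK ?posrE.
Qed.

Variable d : nat.
Implicit Types (S T U V : 'M[R]_d).

Lemma mxtrace_diag_orth (s t : 'rV[R]_d) U :
  \tr (diag_mx s *m U *m diag_mx t *m U^T) =
  \sum_i \sum_j s 0 i * t 0 j * U i j ^+ 2.
Proof.
rewrite /mxtrace; apply: eq_bigr => i _.
rewrite mul_mx_diag mul_diag_mx mxE; apply: eq_bigr => j _.
by rewrite !mxE; ring.
Qed.

(** In the eigenbases [U] and [V] the difference of the two matrices has entries
    [(t_j - s_i) W_ij], with [W] the transition matrix. *)
Lemma frob_diagB (s t : 'rV[R]_d) U V : U^T *m U = 1%:M -> V^T *m V = 1%:M ->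
  let D := V^T *m diag_mx t *m V - U^T *m diag_mx s *m U in
  frob_dot D D = \sum_i \sum_j (t 0 j - s 0 i) ^+ 2 * (U *m V^T) i j ^+ 2.
Proof.
move=> UU VV D; rewrite -(frob_dot_orth D D UU VV).
have -> : U *m D *m V^T = U *m V^T *m diag_mx t - diag_mx s *m (U *m V^T).
  rewrite /D mulmxBr mulmxBl !mulmxA (mulmx1C UU) mul1mx.
  by rewrite -(mulmxA _ V) (mulmx1C VV) mulmx1.
move: (U *m V^T) => W; rewrite frob_dotE.
apply: eq_bigr => i _; apply: eq_bigr => j _.
by rewrite mul_mx_diag mul_diag_mx !mxaddE !mxoppE !mxE; ring.
Qed.

(** A squared Lipschitz bound for [f] between the two spectra lifts to matrices,
    by comparing the expansions of [frob_diagB] term by term.  The quantification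
    over all diagonalizations leaves room for bounds on the eigenvalues. *)
Lemma mxfun_lipschitz f S T (L : R) : S^T = S -> T^T = T ->
  (forall U V s t, U^T *m U = 1%:M -> V^T *m V = 1%:M ->
    S = U^T *m diag_mx s *m U -> T = V^T *m diag_mx t *m V ->
    forall i j, (f (t 0 j) - f (s 0 i)) ^+ 2 <= L * (t 0 j - s 0 i) ^+ 2) ->
  frob_dot (mxfun f T - mxfun f S) (mxfun f T - mxfun f S) <=
  L * frob_dot (T - S) (T - S).
Proof.
move=> /symmetric_spectral[U [s UU SE]] /symmetric_spectral[V [t VV TE]] h.
rewrite (mxfunE _ UU SE) (mxfunE _ VV TE) [X in _ <= _ * frob_dot (X - _) _]TE.
rewrite [X in _ <= _ * frob_dot (_ - X) _]SE
  [X in _ <= _ * frob_dot _ (X - _)]TE.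
rewrite [X in _ <= _ * frob_dot _ (_ - X)]SE !frob_diagB// mulr_sumr.
apply: ler_sum => i _; rewrite mulr_sumr; apply: ler_sum => j _.
rewrite [leRHS]mulrA ![map_mx _ _ _ _]mxE ler_wpM2r ?sqr_ge0//.
by apply: (h U V).
Qed.

(** In a pair of orthonormal eigenbases of [S] and [T], with transition matrix
    [W], both sides are sums over the entries of [W]: the left one has terms
    [(ln b_j - ln a_i)^2 W_ij^2] and the right one
    [(b_j / a_i + a_i / b_j - 2) W_ij^2]. *)
Lemma frob_mxlogB_le S T : spd S -> spd T ->
  frob_dot (mxlog T - mxlog S) (mxlog T - mxlog S) <=
  \tr (invmx S *m T) + \tr (invmx T *m S) - 2 * d%:R.
Proof.
move=> sS sT.
have [U [a [UU SE] a0]] := spd_spectral sS.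
have [V [b [VV TE] b0]] := spd_spectral sT.
have UU' := mulmx1C UU; have VV' := mulmx1C VV.
pose W := U *m V^T.
have WW : W *m W^T = 1%:M.
  by rewrite /W trmx_mul trmxK mulmxA -(mulmxA U) VV mulmx1.
have WT : W^T = V *m U^T by rewrite trmx_mul trmxK.
rewrite /mxlog !invmx_mxfun// !(mxfunE _ UU SE) !(mxfunE _ VV TE).
have -> : frob_dot (V^T *m diag_mx (map_mx (@ln R) b) *m V - U^T *m diag_mx
  (map_mx (@ln R) a) *m U)
    (V^T *m diag_mx (map_mx (@ln R) b) *m V - U^T *m diag_mx (map_mx (@ln R) a)
      *m U) =
    \sum_i \sum_j (ln (b 0 j) - ln (a 0 i)) ^+ 2 * W i j ^+ 2.
  rewrite frob_diagB//; apply: eq_bigr => i _; apply: eq_bigr => j _.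
  by rewrite ![map_mx _ _ _ _]mxE.
have -> : \tr (U^T *m diag_mx (map_mx (fun x => x^-1) a) *m U *m T) =
   \sum_i \sum_j (a 0 i)^-1 * b 0 j * W i j ^+ 2.
  have -> : \sum_i \sum_j (a 0 i)^-1 * b 0 j * W i j ^+ 2 =
      \sum_i \sum_j (map_mx (fun x => x^-1) a) 0 i * b 0 j * W i j ^+ 2.
    by apply: eq_bigr => i _; apply: eq_bigr => j _;
      rewrite [map_mx _ _ _ _]mxE.
  by rewrite -mxtrace_diag_orth TE -!mulmxA mxtrace_mulC WT /W !mulmxA.
have -> : \tr (V^T *m diag_mx (map_mx (fun x => x^-1) b) *m V *m S) =
   \sum_i \sum_j a 0 i * (b 0 j)^-1 * W i j ^+ 2.
  have -> : \sum_i \sum_j a 0 i * (b 0 j)^-1 * W i j ^+ 2 =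
      \sum_i \sum_j a 0 i * (map_mx (fun x => x^-1) b) 0 j * W i j ^+ 2.
    by apply: eq_bigr => i _; apply: eq_bigr => j _;
      rewrite [map_mx _ _ _ _]mxE.
  by rewrite -mxtrace_diag_orth SE !mulmxA -mulmxA mxtrace_mulC WT /W !mulmxA.
have -> : d%:R = \sum_i \sum_j W i j ^+ 2 :> R.
  rewrite -(@mxtrace1 R d) -WW; apply: eq_bigr => i _.
  by rewrite [LHS]mxE; apply: eq_bigr => j _; rewrite [W^T _ _]mxE expr2.
rewrite mulr_sumr -big_split -sumrB /=.
apply: ler_sum => i _; rewrite mulr_sumr -big_split -sumrB /=.
apply: ler_sum => j _; rewrite -mulrDl -mulrBl ler_wpM2r ?sqr_ge0//.
by rewrite (mulrC (a 0 i)^-1) ln_dist_le.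
Qed.

(** The Cauchy-Schwarz inequality, in the form that adds up [N] steps. *)
Lemma frob_dot_sum_le (D : nat -> 'M[R]_d) N :
  frob_dot (\sum_(0 <= k < N) D k) (\sum_(0 <= k < N) D k) <=
  N%:R * \sum_(0 <= k < N) frob_dot (D k) (D k).
Proof.
elim: N => [|N IH]; first by rewrite !big_geq// mul0r /frob_dot mulmx0 mxtrace0.
rewrite !big_nat_recr//=.
move: IH; set A := \sum_(0 <= k < N) D k; set a := D N.
set Q := \sum_(0 <= k < N) _ => IH.
have [N0|N0] := posnP N.
  by rewrite /A /Q N0 !big_geq// !add0r mul1r.
have N0' : 0 < N%:R :> R by rewrite ltr0n.
have := frob_dot_ge0 (A - N%:R *: a).
rewrite !(frob_dotDl, frob_dotDr, frob_dotNl, frob_dotNr, frob_dotZl,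
  frob_dotZr).
rewrite (frob_dotC a A).
move: (frob_dot A A) (frob_dot A a) (frob_dot a a) IH => p q r IH h.
rewrite -natr1; set n := (N%:R : R) in N0' IH h *.
suff : 2 * q <= Q + n * r by nra.
by rewrite -(ler_pM2l N0'); nra.
Qed.

(** This passes to the limit [N -> oo] in the subdivision argument. *)
Lemma le_expR_archimedean (a b L : R) : 0 <= a -> 0 <= L ->
  (forall N, a <= b * expR (L / N.+1%:R)) -> a <= b.
Proof.
move=> a0 L0 h; rewrite leNgt; apply/negP => ab.
pose c := a - b; have c0 : 0 < c by rewrite subr_gt0.
pose N := Num.bound (a * L / c).
have hN : a * L / c < N.+1%:R.
  apply: (lt_le_trans (archi_boundP _)); last by rewrite ler_nat.
  by rewrite divr_ge0 ?mulr_ge0// ltW.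
have N0 : 0 < N.+1%:R :> R by rewrite ltr0n.
have := h N; set e := expR _ => he.
have e' : 1 - L / N.+1%:R <= e^-1 by rewrite -expRN; apply: expR_ge1Dx.
have : a * e^-1 <= b by rewrite ler_pdivrMr ?expR_gt0.
apply/negP; rewrite -ltNge; apply: (@lt_le_trans _ _ (a * (1 - L / N.+1%:R))).
  rewrite mulrBr mulr1 ltrBrDr -ltrBrDl -/c mulrA ltr_pdivrMr//.
  by move: hN; rewrite ltr_pdivrMr// mulrC (mulrC N.+1%:R) (mulrC L).
by rewrite ler_wpM2l.
Qed.

Lemma invmx_unique (A B : 'M[R]_d) : B *m A = 1%:M -> invmx A = B.
Proof.
move=> BA; have [_ uA] := mulmx1_unit BA.
by rewrite -[RHS](mulmxK uA) BA mul1mx.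
Qed.

(** The exponential metric increasing property.  The geodesic [G] from [S]
    to [T] is cut into [N + 1] equal steps: [frob_mxlogB_le] bounds each of them
    by a quantity that only depends on the eigenvalues of [mxlog (whiten S T)]
    divided by [N + 1]. *)
Theorem frob_mxlogB_le_ai_dist S T : spd S -> spd T ->
  frob_norm (mxlog T - mxlog S) <= ai_dist S T.
Proof.
move=> sS sT; have sW := whiten_spd sS sT.
pose X := mxlog (whiten S T).
have symX : X^T = X by apply: mxlog_trmx.
have [U [x UU XE]] := symmetric_spectral symX.
pose E t := mxfun (fun y => expR (t * y)) X.
pose q := mxsqrt S; pose P := mxinvsqrt S.
have symq : q^T = q by apply/spd_sym/spd_mxsqrt.
have uq : q \in unitmx by apply: mxsqrt_unit.
have sE t : spd (E t) by apply: spd_mxfun_pos => // y; apply: expR_gt0.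
have ED s t : E s *m E t = E (s + t).
  by rewrite mxfunM//; apply: eq_mxfun => // y; rewrite -expRD mulrDl.
have E0 : E 0 = 1%:M.
  by rewrite -(mxfun1 symX); apply: eq_mxfun => // y; rewrite mul0r expR0.
have E1 : E 1 = whiten S T.
  by rewrite -(mxlogK sW); apply: eq_mxfun => // y; rewrite mul1r.
have qE : q *m q = S by apply: mxsqrtK.
have qW : q *m whiten S T *m q = T by apply: whitenK.
have qP : q *m P = 1%:M by apply: mulmxV.
have Pq : P *m q = 1%:M by apply: mulVmx.
have trE t : \tr (E t) = \sum_i expR (t * x 0 i).
  rewrite /E (mxfunE _ UU XE) mxtrace_mulC mulmxA (mulmx1C UU) mul1mx
    mxtrace_diag.
  by apply: eq_bigr => i _; rewrite mxE.
clearbody E P q.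
have [G GE] : exists G, forall t, G t = q *m E t *m q by eexists.
have sG t : spd (G t) by rewrite GE -{1}symq; apply: spd_congr.
have G0 : G 0 = S by rewrite GE E0 mulmx1.
have G1 : G 1 = T by rewrite GE E1.
have trG s t : \tr (invmx (G s) *m G t) = \sum_i expR ((t - s) * x 0 i).
  have -> : invmx (G s) = P *m E (- s) *m P.
    apply: invmx_unique; rewrite GE !mulmxA -(mulmxA _ P q) Pq mulmx1.
    by rewrite -(mulmxA P) ED addNr E0 mulmx1.
  rewrite GE !mulmxA -(mulmxA _ P q) Pq mulmx1 -(mulmxA P) ED.
  by rewrite mxtrace_mulC mulmxA qP mul1mx trE addrC.
rewrite /ai_dist -/X frob_norm_le XE frob_diag//.
pose L := \sum_i `|x 0 i|.
apply: (@le_expR_archimedean _ _ L);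
  [exact: frob_dot_ge0|by apply: sumr_ge0|move=> N].
pose n : R := N.+1%:R; have n0 : 0 < n by rewrite ltr0n.
pose D k := mxlog (G (k.+1%:R / n)) - mxlog (G (k%:R / n)).
have -> : mxlog T - mxlog S = \sum_(0 <= k < N.+1) D k.
  rewrite (telescope_sumr (fun k => mxlog (G (k%:R / n))))// mul0r G0.
  by rewrite divff ?gt_eqF// G1.
apply: (le_trans (frob_dot_sum_le _ _)).
have hD k : frob_dot (D k) (D k) <= \sum_i (x 0 i ^+ 2 * expR (L / n)) / n ^+ 2.
  apply: (le_trans (frob_mxlogB_le (sG _) (sG _))); rewrite !trG.
  have -> : k.+1%:R / n - k%:R / n = n^-1
    by rewrite -mulrBl -natrB// subSnn mul1r.
  have -> : k%:R / n - k.+1%:R / n = - n^-1.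
    by rewrite -mulrBl -opprB -natrB// subSnn mulN1r.
  have -> : 2 * d%:R = \sum_(i < d) 2 :> R
    by rewrite sumr_const card_ord mulr_natr.
  rewrite -big_split -sumrB /=; apply: ler_sum => i _.
  rewrite mulNr; apply: (le_trans (coshB2_le _)).
  have -> : (n^-1 * x 0 i) ^+ 2 * expR `|n^-1 * x 0 i| =
    x 0 i ^+ 2 * expR `|n^-1 * x 0 i| / n ^+ 2.
    by rewrite exprMn exprVn; ring.
  rewrite ler_wpM2r ?invr_ge0 ?sqr_ge0//.
  rewrite ler_wpM2l ?sqr_ge0// ler_expR normrM [leLHS]mulrC
    [X in _ * X]ger0_norm ?invr_ge0 ?(ltW n0)//.
  apply: ler_wpM2r; first by rewrite invr_ge0 ltW.
  by rewrite /L (bigD1 i)//= lerDl; exact: sumr_ge0.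
apply: (@le_trans _ _
  (n * \sum_(0 <= k < N.+1) \sum_i (x 0 i ^+ 2 * expR (L / n)) / n ^+ 2)).
  by rewrite ler_pM2l//; apply: ler_sum => k _.
rewrite sumr_const_nat subn0 -mulr_suml -mulr_suml -[_ *+ N.+1]mulr_natl -/n.
have n0' : n != 0 by rewrite gt_eqF.
rewrite le_eqVlt; apply/orP; left; apply/eqP.
by rewrite mulrA -expr2 mulrC divfK ?expf_neq0.
Qed.

End MetricIncreasing.

(** * Limits of matrices and continuity of the spectral functions *)

Section MatrixTopology.
Context {R : realType}.

Lemma cvg_mxP T (F : set_system T) {FF : Filter F} m n
    (f : T -> 'M[R]_(m, n)) (l : 'M[R]_(m, n)) :
  f @ F --> l <-> forall i j, f x i j @[x --> F] --> l i j.
Proof.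
split=> [fl i j|fl].
  exact: cvg_comp fl (@coord_continuous _ _ _ i j l).
move=> A [P lP PA]; apply:
  (@filterS _ F _ [set x | forall i j, P i j (f x i j)]).
  by move=> x Px; apply: PA.
apply: filter_forall => i; apply: filter_forall => j; exact: fl (lP i j).
Qed.

Lemma cvg_sumr T (F : set_system T) {FF : Filter F} I (r : seq I) (P : pred I)
    (f : I -> T -> R) (l : I -> R) :
  (forall i, f i x @[x --> F] --> l i) ->
  \sum_(i <- r | P i) f i x @[x --> F] --> \sum_(i <- r | P i) l i.
Proof.
move=> fl; by apply: cvg_big => //; exact: add_continuous.
Qed.

Lemma cvg_prodr T (F : set_system T) {FF : Filter F} I (r : seq I) (P : pred I)
    (f : I -> T -> R) (l : I -> R) :
  (forall i, f i x @[x --> F] --> l i) ->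
  \prod_(i <- r | P i) f i x @[x --> F] --> \prod_(i <- r | P i) l i.
Proof.
move=> fl; by apply: cvg_big => //; exact: mul_continuous.
Qed.

Lemma cvg_mulmx T (F : set_system T) {FF : Filter F} m n p
    (f : T -> 'M[R]_(m, n)) (g : T -> 'M[R]_(n, p)) (l : 'M[R]_(m, n))
      (k : 'M[R]_(n, p)) :
  f @ F --> l -> g @ F --> k -> f x *m g x @[x --> F] --> l *m k.
Proof.
move=> /cvg_mxP fl /cvg_mxP gk; apply/cvg_mxP => i j; rewrite mxE.
under eq_cvg do rewrite mxE.
by apply: cvg_sumr => h; apply: cvgM.
Qed.

Lemma cvg_trmx T (F : set_system T) {FF : Filter F} m n
    (f : T -> 'M[R]_(m, n)) (l : 'M[R]_(m, n)) : f @ F --> l ->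
      (f x)^T @[x --> F] --> l^T.
Proof.
move=> /cvg_mxP fl; apply/cvg_mxP => i j; rewrite mxE.
by under eq_cvg do rewrite mxE; exact: fl.
Qed.

Lemma cvg_det T (F : set_system T) {FF : Filter F} n (f : T -> 'M[R]_n)
  (l : 'M[R]_n) :
  f @ F --> l -> \det (f x) @[x --> F] --> \det l.
Proof.
move=> /cvg_mxP fl; apply: cvg_sumr => s; apply: cvgM; first exact: cvg_cst.
exact: cvg_prodr.
Qed.

Lemma cvg_mxtrace T (F : set_system T) {FF : Filter F} n (f : T -> 'M[R]_n)
  (l : 'M[R]_n) :
  f @ F --> l -> \tr (f x) @[x --> F] --> \tr l.
Proof. by move=> /cvg_mxP fl; apply: cvg_sumr. Qed.

(** The cofactor formula: the determinant stays away from [0] near the limit. *)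
Lemma cvg_invmx T (F : set_system T) {FF : Filter F} n (f : T -> 'M[R]_n)
  (l : 'M[R]_n) :
  l \in unitmx -> f @ F --> l -> invmx (f x) @[x --> F] --> invmx l.
Proof.
move=> ul fl; have dl : \det l != 0 by rewrite -unitfE -unitmxE.
have uf : \forall x \near F, (\det (f x))^-1 *: \adj (f x) = invmx (f x).
  near=> x; rewrite /invmx unitmxE unitfE ifT//.
  by near: x; apply: cvgr_neq0 dl; exact: cvg_det.
apply: (cvg_trans (near_eq_cvg uf)); rewrite /invmx ul.
apply/cvg_mxP => i j; rewrite !mxE; under eq_cvg do rewrite !mxE.
apply: cvgM; first by apply: cvgV => //; exact: cvg_det.
apply: cvgM; first exact: cvg_cst.
apply: cvg_det; apply/cvg_mxP => a b; rewrite !mxE;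
  under eq_cvg do rewrite !mxE.
by move/cvg_mxP: fl; apply.
Unshelve. all: by end_near. Qed.

End MatrixTopology.

Section SpectralContinuity.
Context {R : realType} {d : nat}.
Implicit Types (S T X Y : 'M[R]_d).

Lemma sqr_le_frob X i j : X i j ^+ 2 <= frob_dot X X.
Proof.
rewrite frob_dotE (bigD1 i)//= (bigD1 j)//= -expr2 -addrA lerDl.
by rewrite addr_ge0 ?sumr_ge0// => *; rewrite ?sumr_ge0// => *;
  rewrite -expr2 sqr_ge0.
Qed.

(** A squeeze principle: each entry is dominated by the Frobenius norm. *)
Lemma cvg_frob A (F : set_system A) {FF : Filter F} (f : A -> 'M[R]_d)
    (g : A -> R) (l : 'M[R]_d) :
  (\forall x \near F, frob_dot (f x - l) (f x - l) <= g x) ->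
  g @ F --> 0 -> f @ F --> l.
Proof.
move=> fg /cvgrPdist_lt g0; apply/cvg_mxP => i j; apply/cvgrPdist_lt => e e0.
have e20 : 0 < e ^+ 2 by rewrite exprn_gt0.
near=> x; rewrite -ltr_sqr ?nnegrE ?normr_ge0 ?(ltW e0)//.
rewrite real_normK ?num_real// -sqrrN opprB.
have -> : f x i j - l i j = (f x - l) i j by rewrite mxaddE mxoppE.
apply: le_lt_trans (sqr_le_frob _ _ _) _.
have h : frob_dot (f x - l) (f x - l) <= g x by near: x.
apply: (le_lt_trans h); apply: le_lt_trans (ler_norm _) _.
by rewrite -normrN -sub0r; near: x; apply: g0.
Unshelve. all: by end_near. Qed.

(** The bound of [frob_mxlogB_le] is continuous in [T] and vanishes at [S]. *)
Lemma cvg_mxlog A (F : set_system A) {FF : Filter F} (f : A -> 'M[R]_d) S :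
  spd S -> (\forall x \near F, spd (f x)) -> f @ F --> S ->
  mxlog (f x) @[x --> F] --> mxlog S.
Proof.
move=> sS sf fS; apply: (@cvg_frob _ _ _ _
    (fun x => \tr (invmx S *m f x) + \tr (invmx (f x) *m S) - 2 * d%:R)).
  by apply: filterS sf => x; apply: frob_mxlogB_le.
have -> : 0 = \tr (invmx S *m S) + \tr (invmx S *m S) - 2 * d%:R :> R.
  by rewrite mulVmx ?spd_unit// mxtrace1; ring.
apply: cvgB; last exact: cvg_cst.
apply: cvgD; apply: cvg_mxtrace; apply: cvg_mulmx => //; try exact: cvg_cst.
by apply: cvg_invmx => //; apply: spd_unit.
Qed.

Lemma expR_lipschitz (r x y : R) : x <= r -> y <= r ->
  (expR y - expR x) ^+ 2 <= expR r ^+ 2 * (y - x) ^+ 2.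
Proof.
wlog xy : x y / x <= y.
  move=> h xr yr; have [/h|/ltW /h] := leP x y; first exact.
  by rewrite -(sqrrN (_ - _)) -(sqrrN (y - x)) !opprB; apply.
move=> xr yr; rewrite -exprMn ler_sqr ?nnegrE ?mulr_ge0 ?expR_ge0 ?subr_ge0
  ?ler_expR//.
have -> : expR y - expR x = expR y * (1 - expR (x - y)).
  by rewrite mulrBr mulr1 -expRD (addrC y) subrK.
apply: ler_pM; rewrite ?expR_ge0 ?ler_expR//.
  by rewrite subr_ge0 -expR0 ler_expR subr_le0.
have := expR_ge1Dx (x - y); lra.
Qed.

Lemma frob_mxexpB_le X Y (r : R) : X^T = X -> Y^T = Y ->
  frob_norm X <= r -> frob_norm Y <= r ->
  frob_dot (mxexp Y - mxexp X) (mxexp Y - mxexp X) <=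
  expR r ^+ 2 * frob_dot (Y - X) (Y - X).
Proof.
move=> symX symY Xr Yr; apply: mxfun_lipschitz => // U V s t UU VV XE YE i j.
have r0 : 0 <= r by apply: le_trans Xr; exact: frob_norm_ge0.
have spec (Z W : 'M[R]_d) (u : 'rV[R]_d) k : frob_norm Z <= r -> W^T *m W =
  1%:M ->
    Z = W^T *m diag_mx u *m W -> u 0 k <= r.
  move=> Zr WW ZE; apply: le_trans (ler_norm _) _.
  rewrite -ler_sqr ?nnegrE// real_normK ?num_real//.
  apply: (@le_trans _ _ (frob_norm Z ^+ 2)).
    rewrite frob_normK ZE frob_diag// (bigD1 k)//= lerDl.
    by apply: sumr_ge0 => *; rewrite sqr_ge0.
  by rewrite ler_sqr ?nnegrE ?frob_norm_ge0.
by apply: expR_lipschitz; [apply: (spec X U)|apply: (spec Y V)].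
Qed.

Lemma cvg_frob_dot A (F : set_system A) {FF : Filter F} (f g : A -> 'M[R]_d)
    (k l : 'M[R]_d) : f @ F --> k -> g @ F --> l ->
  frob_dot (f x) (g x) @[x --> F] --> frob_dot k l.
Proof. by move=> fk gl; apply: cvg_mxtrace; apply: cvg_mulmx => //;
  apply: cvg_trmx. Qed.

(** Near [X] the Frobenius norms are at most [frob_norm X + 1], and the
    exponential is Lipschitz on that ball of symmetric matrices. *)
Lemma cvg_mxexp A (F : set_system A) {FF : Filter F} (f : A -> 'M[R]_d) X :
  X^T = X -> (forall x, (f x)^T = f x) -> f @ F --> X ->
  mxexp (f x) @[x --> F] --> mxexp X.
Proof.
move=> symX symf fX; pose r := frob_norm X + 1.
apply: (@cvg_frob _ _ _ _
  (fun x => expR r ^+ 2 * frob_dot (f x - X) (f x - X))).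
  near=> x; apply: frob_mxexpB_le => //; first by rewrite lerDl ler01.
  rewrite -ler_sqr ?nnegrE ?frob_norm_ge0 ?addr_ge0 ?frob_norm_ge0//.
  rewrite frob_normK; apply: ltW; near: x; apply: (cvgr_lt (frob_dot X X)).
    exact: cvg_frob_dot.
  by rewrite -frob_normK ltr_sqr ?nnegrE ?frob_norm_ge0 ?addr_ge0
    ?frob_norm_ge0// ltrDl.
rewrite -(mulr0 (expR r ^+ 2)); apply: cvgM; first exact: cvg_cst.
have -> : 0 = frob_dot (X - X) (X - X)
  by rewrite subrr /frob_dot mulmx0 mxtrace0.
by apply: cvg_frob_dot; apply: cvgB => //; exact: cvg_cst.
Unshelve. all: by end_near. Qed.

End SpectralContinuity.

(** * Spectral functions of Kronecker products and partial traces *)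

Section KroneckerSpectral.
Context {R : realType} {m n : nat}.
Implicit Types (A Z V : 'M[R]_m) (B Y U : 'M[R]_n).

Lemma mxtens_index_eq (p q : 'I_n) (i j : 'I_m) :
  (mxtens_index (p, i) == mxtens_index (q, j)) = (p == q) && (i == j).
Proof. by rewrite (can_eq (@mxtens_indexK n m)) xpair_eqE. Qed.

Lemma tensmx11 : (1%:M : 'M[R]_n) *t (1%:M : 'M[R]_m) = 1%:M.
Proof.
apply/matrixP => k l; case: (mxtens_indexP k) => p i;
  case: (mxtens_indexP l) => q j.
rewrite tensmxE !mxE mxtens_index_eq.
by case: (p == q); case: (i == j); rewrite ?mulr1n ?mulr0n ?mulr1 ?mulr0.
Qed.

Lemma tensmxDl B B' A : (B + B') *t A = B *t A + B' *t A.
Proof. by apply/matrixP => k l; rewrite !mxE mulrDl. Qed.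

Lemma tensmxDr B A A' : B *t (A + A') = B *t A + B *t A'.
Proof. by apply/matrixP => k l; rewrite !mxE mulrDr. Qed.

Lemma tensmxZl a B A : (a *: B) *t A = a *: (B *t A).
Proof. by apply/matrixP => k l; rewrite !mxE mulrA. Qed.

Lemma tensmxZr a B A : B *t (a *: A) = a *: (B *t A).
Proof. by apply/matrixP => k l; rewrite !mxE mulrCA. Qed.

(** The diagonal of the Kronecker product of two diagonal matrices. *)
Definition tens_row (s : 'rV[R]_n) (t : 'rV[R]_m) : 'rV[R]_(n * m) :=
  \row_k (s 0 (mxtens_unindex k).1 * t 0 (mxtens_unindex k).2).

Lemma tens_diag s t : diag_mx s *t diag_mx t = diag_mx (tens_row s t).
Proof.
apply/matrixP => k l; case: (mxtens_indexP k) => p i;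
  case: (mxtens_indexP l) => q j.
rewrite tensmxE !mxE mxtens_index_eq mxtens_indexK /=.
by case: (p == q); case: (i == j); rewrite ?mulr1n ?mulr0n ?mulr1 ?mulr0 ?mul0r.
Qed.

Lemma tens_orth U V : U^T *m U = 1%:M -> V^T *m V = 1%:M ->
  (U *t V)^T *m (U *t V) = 1%:M.
Proof. by move=> UU VV; rewrite trmx_tens tensmx_mul UU VV tensmx11. Qed.

Lemma tens_diagonalized U V s t :
  (U^T *m diag_mx s *m U) *t (V^T *m diag_mx t *m V) =
  (U *t V)^T *m diag_mx (tens_row s t) *m (U *t V).
Proof. by rewrite trmx_tens -tens_diag !tensmx_mul. Qed.

Lemma spd_tens B A : spd B -> spd A -> spd (B *t A).
Proof.
move=> /spd_spectral[U [s [UU ->] s0]] /spd_spectral[V [t [VV ->] t0]].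
rewrite tens_diagonalized; apply/spd_diag => [|k]; first exact: tens_orth.
by rewrite mxE mulr_gt0.
Qed.

Lemma mxfun_tensM (f : R -> R) B A : spd B -> spd A ->
  (forall x y, 0 < x -> 0 < y -> f (x * y) = f x * f y) ->
  mxfun f (B *t A) = mxfun f B *t mxfun f A.
Proof.
move=> /spd_spectral[U [s [UU BE] s0]] /spd_spectral[V [t [VV AE] t0]] fM.
rewrite (mxfunE f UU BE) (mxfunE f VV AE) BE AE !tens_diagonalized.
rewrite (mxfunE f (tens_orth UU VV) erefl); congr (_ *m diag_mx _ *m _).
by apply/rowP => k; rewrite !mxE fM.
Qed.

Lemma mxfun_tens1r (f : R -> R) Y : Y^T = Y ->
  mxfun f (Y *t (1%:M : 'M[R]_m)) = mxfun f Y *t 1%:M.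
Proof.
move=> /symmetric_spectral[U [s UU YE]].
have E1 : (1%:M : 'M[R]_m) = 1%:M^T *m diag_mx (const_mx 1) *m 1%:M.
  by rewrite trmx1 mul1mx mulmx1 diag_const_mx.
rewrite [X in _ *t X]E1 (mxfunE f UU YE) YE !tens_diagonalized.
rewrite (mxfunE f (tens_orth UU _) erefl); last by rewrite trmx1 mulmx1.
rewrite [in RHS]E1 tens_diagonalized.
congr (_ *m diag_mx _ *m _).
by apply/rowP => k; rewrite !mxE !mulr1.
Qed.

Lemma mxfun_tens1l (f : R -> R) Z : Z^T = Z ->
  mxfun f ((1%:M : 'M[R]_n) *t Z) = 1%:M *t mxfun f Z.
Proof.
move=> /symmetric_spectral[U [s UU YE]].
have E1 : (1%:M : 'M[R]_n) = 1%:M^T *m diag_mx (const_mx 1) *m 1%:M.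
  by rewrite trmx1 mul1mx mulmx1 diag_const_mx.
rewrite [X in X *t _]E1 (mxfunE f UU YE) YE !tens_diagonalized.
rewrite (mxfunE f (tens_orth _ UU) erefl); last by rewrite trmx1 mulmx1.
rewrite [in RHS]E1 tens_diagonalized.
congr (_ *m diag_mx _ *m _).
by apply/rowP => k; rewrite !mxE !mul1r.
Qed.

(** The logarithm turns products of eigenvalues into sums: the logarithms of the
    Kronecker family form the linear space of the [Y *t 1 + 1 *t Z] with
    [Y] and [Z] symmetric. *)
Lemma mxlog_tens B A : spd B -> spd A ->
  mxlog (B *t A) = mxlog B *t 1%:M + 1%:M *t mxlog A.
Proof.
move=> /spd_spectral[U [s [UU BE] s0]] /spd_spectral[V [t [VV AE] t0]].
rewrite /mxlog (mxfunE _ UU BE) (mxfunE _ VV AE).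
have E1 : (1%:M : 'M[R]_n) = U^T *m diag_mx (const_mx 1) *m U.
  by rewrite diag_const_mx mulmx1.
have E2 : (1%:M : 'M[R]_m) = V^T *m diag_mx (const_mx 1) *m V.
  by rewrite diag_const_mx mulmx1.
rewrite BE AE [X in _ = _ *t X + _]E2 [X in _ = _ + X *t _]E1
  !tens_diagonalized.
rewrite (mxfunE _ (tens_orth UU VV) erefl) -mulmxDl -mulmxDr -linearD /=.
congr (_ *m diag_mx _ *m _); apply/rowP => k.
by rewrite !mxE mulr1 mul1r lnM ?posrE.
Qed.

Lemma invmx_tens B A : B \in unitmx -> A \in unitmx ->
  invmx (B *t A) = invmx B *t invmx A.
Proof. by move=> uB uA; apply: invmx_unique;
  rewrite tensmx_mul !mulVmx// tensmx11. Qed.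

Lemma mxsqrt_tens B A : spd B -> spd A ->
  mxsqrt (B *t A) = mxsqrt B *t mxsqrt A.
Proof.
by move=> sB sA; apply: mxfun_tensM => // x y x0 y0; rewrite sqrtrM// ltW.
Qed.

Lemma mxinvsqrt_tens B A : spd B -> spd A ->
  mxinvsqrt (B *t A) = mxinvsqrt B *t mxinvsqrt A.
Proof.
by move=> sB sA; rewrite /mxinvsqrt mxsqrt_tens// invmx_tens// mxsqrt_unit.
Qed.

Lemma whiten_tens B A Y Z : spd B -> spd A ->
  whiten (B *t A) (Y *t Z) = whiten B Y *t whiten A Z.
Proof. by move=> sB sA; rewrite /whiten mxinvsqrt_tens// !tensmx_mul. Qed.

Lemma sum_mxtens_index (F : 'I_(n * m) -> R) :
  \sum_k F k = \sum_p \sum_i F (mxtens_index (p, i)).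
Proof.
rewrite (reindex (@mxtens_index n m)) /=; last first.
  by exists (@mxtens_unindex n m) => k _;
    rewrite (mxtens_indexK, mxtens_unindexK).
by rewrite [RHS]pair_bigA; apply: eq_bigr => -[].
Qed.

(** [ptraceA] and [ptraceB] are the adjoints, for the Frobenius inner product,
    of the embeddings [Y |-> Y *t 1] and [Z |-> 1 *t Z]. *)
Lemma frob_dot_tensr (L : 'M[R]_(n * m)) Y :
  frob_dot L (Y *t 1%:M) = frob_dot (ptraceA L) Y.
Proof.
rewrite !frob_dotE sum_mxtens_index; apply: eq_bigr => p _.
under eq_bigr do rewrite sum_mxtens_index.
rewrite exchange_big /=; apply: eq_bigr => q _.
rewrite mxE /mxtrace mulr_suml; apply: eq_bigr => i _.
rewrite (bigD1 i)//= big1 => [|j /negPf ji].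
  by rewrite tensmxE !mxE eqxx mulr1 addr0.
by rewrite tensmxE mxE eq_sym ji mulr0 mulr0.
Qed.

Lemma frob_dot_tensl (L : 'M[R]_(n * m)) Z :
  frob_dot L (1%:M *t Z) = frob_dot (ptraceB L) Z.
Proof.
rewrite !frob_dotE sum_mxtens_index exchange_big /=; apply: eq_bigr => i _.
under eq_bigr do rewrite sum_mxtens_index exchange_big.
rewrite exchange_big /=; apply: eq_bigr => j _.
rewrite summxE mulr_suml; apply: eq_bigr => p _.
rewrite (bigD1 p)//= big1 => [|q /negPf qp].
  by rewrite tensmxE !mxE eqxx mul1r addr0.
by rewrite tensmxE mxE eq_sym qp mul0r mulr0.
Qed.

Lemma ptraceA_trmx (L : 'M[R]_(n * m)) : L^T = L -> (ptraceA L)^T = ptraceA L.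
Proof.
move=> symL; apply/matrixP => p q; rewrite !mxE; apply: eq_bigr => i _.
by rewrite !mxE -[in LHS]symL mxE.
Qed.

Lemma ptraceB_trmx (L : 'M[R]_(n * m)) : L^T = L -> (ptraceB L)^T = ptraceB L.
Proof.
move=> symL; apply/matrixP => i j; rewrite mxE !summxE; apply: eq_bigr => p _.
by rewrite !mxE -[in LHS]symL mxE.
Qed.

End KroneckerSpectral.

(** * The Kronecker family as a closed set *)

Section Submatrices.
Context {R : realType}.

(** A principal submatrix is [E^T S E] for an injective selection matrix [E]. *)
Lemma spd_mxsub d k (S : 'M[R]_d) (f : 'I_k -> 'I_d) : injective f ->
  spd S -> spd (mxsub f f S).
Proof.
move=> injf [/symmetricmxP symS posS].
pose E : 'M[R]_(d, k) := \matrix_(a, i) (a == f i)%:R.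
have EE : E^T *m E = 1%:M.
  apply/matrixP => i j; rewrite !mxE (bigD1 (f i))//= big1 => [|a /negPf ai].
    by rewrite !mxE eqxx mul1r addr0 (inj_eq injf).
  by rewrite !mxE ai mul0r.
have -> : mxsub f f S = E^T *m S *m E.
  have SE : S *m E = colsub f S.
    apply/matrixP => a j; rewrite !mxE (bigD1 (f j))//= big1 => [|b /negPf bj].
      by rewrite mxE eqxx mulr1 addr0.
    by rewrite mxE bj mulr0.
  rewrite -mulmxA SE; apply/matrixP => i j.
  rewrite !mxE (bigD1 (f i))//= big1 => [|b /negPf bi].
    by rewrite !mxE eqxx mul1r addr0.
  by rewrite !mxE bi mul0r.
split=> [|x x0].
  by apply/symmetricmxP; rewrite !trmx_mul trmxK symS mulmxA.
rewrite !mulmxA -trmx_mul -(mulmxA _ E); apply: posS.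
by apply: contra_neq x0 => /(congr1 (mulmx E^T));
  rewrite mulmxA EE mul1mx mulmx0.
Qed.

Lemma spd_scale d (S : 'M[R]_d) a : 0 < a -> spd S -> spd (a *: S).
Proof.
move=> a0 [/symmetricmxP symS posS]; split=> [|x x0].
  by apply/symmetricmxP; rewrite linearZ /= symS.
by rewrite -scalemxAr -scalemxAl mxscaleE mulr_gt0// posS.
Qed.

Lemma spd_diag_gt0 d (S : 'M[R]_d) i : spd S -> 0 < S i i.
Proof.
move=> [_ /(_ (delta_mx i 0))]; rewrite trmx_delta -rowE -colE !mxE; apply.
by apply/eqP => /matrixP/(_ i 0); rewrite !mxE !eqxx; apply/eqP;
  rewrite oner_eq0.
Qed.

End Submatrices.

Section KroneckerClosed.
Context {R : realType} {m n : nat}.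
Variables (i0 : 'I_m) (p0 : 'I_n).
Local Notation K := (kronecker_family R m n).
Implicit Types (G M : 'M[R]_(n * m)).

Local Notation e p i := (mxtens_index (p, i)).

(** Tensor rank at most one, tested with a single pivot entry.  One pivot is
    enough for positive-definite matrices, whose diagonal entries are positive. *)
Definition kronecker_minors : set 'M[R]_(n * m) :=
  [set G | forall p q i j, G (e p0 i0) (e p0 i0) * G (e p i) (e q j) =
                           G (e p i0) (e q i0) * G (e p0 i) (e p0 j)].

Lemma kronecker_family_spd : K `<=` spd.
Proof. by move=> _ [A [B [sA sB ->]]]; apply: spd_tens. Qed.

Lemma kronecker_family_minors : K = kronecker_minors `&` spd.
Proof.
apply/seteqP; split=> [_ [A [B [sA sB ->]]]|G [hG sG]].
  split; last exact: spd_tens.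
  by move=> p q i j; rewrite !tensmxE; ring.
have g0 := spd_diag_gt0 (e p0 i0) sG; set g := G _ _ in g0.
exists (mxsub (fun i => e p0 i) (fun i => e p0 i) G).
exists (g^-1 *: mxsub (fun p => e p i0) (fun p => e p i0) G).
split.
- by apply: spd_mxsub => // i j /(can_inj (@mxtens_indexK n m))[].
- apply: spd_scale; first by rewrite invr_gt0.
  by apply: spd_mxsub => // i j /(can_inj (@mxtens_indexK n m))[].
apply/matrixP => k l; case: (mxtens_indexP k) => p i;
  case: (mxtens_indexP l) => q j.
rewrite tensmxE !mxE -mulrA; apply: (mulfI (lt0r_neq0 g0)).
by rewrite mulVKf ?gt_eqF//; apply: hG.
Qed.

Lemma closed_kronecker_minors : closed kronecker_minors.
Proof.
pose g (t : 'I_n * 'I_n * 'I_m * 'I_m) (G : 'M[R]_(n * m)) : R :=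
  G (e p0 i0) (e p0 i0) * G (e t.1.1.1 t.1.2) (e t.1.1.2 t.2) -
  G (e t.1.1.1 i0) (e t.1.1.2 i0) * G (e p0 t.1.2) (e p0 t.2).
have -> : kronecker_minors = \bigcap_(t in setT) (g t @^-1` [set 0]).
  apply/seteqP; split=> [G hG [[[p q] i] j] _|G hG p q i j].
    by apply/eqP; rewrite /g /= subr_eq0; apply/eqP; apply: hG.
  by have /eqP := hG (p, q, i, j) I; rewrite /g /= subr_eq0 => /eqP.
apply: (@closed_bigI _ _ setT (fun t => g t @^-1` [set 0])) => t _.
have cg (G : 'M[R]_(n * m)) : g t x @[x --> G] --> g t G.
  have FG : Filter (nbhs G) := nbhs_filter G.
  by apply: cvgB; apply: cvgM; exact: coord_continuous.
by apply: preimage_closed => [G _|]; [exact: cg|exact: closed_eq].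
Qed.

Lemma closed_in_kronecker_family : closed_in spd K.
Proof.
exists kronecker_minors; first exact: closed_kronecker_minors.
exact: kronecker_family_minors.
Qed.

Lemma kronecker_family1 : K 1%:M.
Proof. by exists 1%:M, 1%:M; split; rewrite ?tensmx11//; exact: spd1. Qed.

End KroneckerClosed.

Section KroneckerCongruence.
Context {R : realType} {m n : nat}.
Local Notation K := (kronecker_family R m n).
Implicit Types (G M X : 'M[R]_(n * m)).

Lemma kronecker_family_congr_sqrt G H : K G -> K H ->
  K (mxsqrt G *m H *m mxsqrt G).
Proof.
move=> [A [B [sA sB ->]]] [A' [B' [sA' sB' ->]]].
rewrite mxsqrt_tens// !tensmx_mul; do 2!eexists; split; last by [].
  rewrite -{1}(spd_sym (spd_mxsqrt sA)); apply: spd_congr => //.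
  exact: mxsqrt_unit.
rewrite -{1}(spd_sym (spd_mxsqrt sB)); apply: spd_congr => //.
exact: mxsqrt_unit.
Qed.

Lemma mxlog_whiten_kronecker G H : K G -> K H ->
  exists Y Z, [/\ Y^T = Y, Z^T = Z & mxlog (whiten G H) =
    Y *t 1%:M + 1%:M *t Z].
Proof.
move=> [A [B [sA sB ->]]] [A' [B' [sA' sB' ->]]].
rewrite whiten_tens// mxlog_tens; [|exact: whiten_spd..].
by do 2!eexists; split; [| |by []]; apply: mxlog_trmx; exact: whiten_spd.
Qed.

Lemma mxexp_tens1r (Y : 'M[R]_n) : Y^T = Y -> K (mxexp (Y *t (1%:M : 'M[R]_m))).
Proof.
move=> symY; exists 1%:M, (mxexp Y); split; [exact: spd1|exact: mxexp_spd|].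
by rewrite /mxexp mxfun_tens1r.
Qed.

Lemma mxexp_tens1l (Z : 'M[R]_m) : Z^T = Z -> K (mxexp ((1%:M : 'M[R]_n) *t Z)).
Proof.
move=> symZ; exists (mxexp Z), 1%:M; split; [exact: mxexp_spd|exact: spd1|].
by rewrite /mxexp mxfun_tens1l.
Qed.

End KroneckerCongruence.

(** * Comparison at a base point and first-order condition *)

Section Comparison.
Context {R : realType} {d : nat}.
Implicit Types (G H M S X : 'M[R]_d).

(** The congruence by [G^(-1/2)] preserves the distance and turns it into a
    distance between whitened matrices, where the logarithm is contracting. *)
Lemma ai_dist_ge_log G M H : spd G -> spd M -> spd H ->
  frob_norm (mxlog (whiten G M) - mxlog (whiten G H)) <= ai_dist M H.
Proof.
move=> sG sM sH; rewrite -(ai_dist_congr sM sH (mxinvsqrt_unit sG)).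
rewrite !whiten_congr// ai_dist_sym; [|exact: whiten_spd..].
by apply: frob_mxlogB_le_ai_dist; exact: whiten_spd.
Qed.

Lemma ai_dist_log G M : spd G -> spd M ->
  ai_dist M G = frob_norm (mxlog (whiten G M)).
Proof. by move=> sG sM; rewrite ai_dist_sym. Qed.

Lemma frob_norm_sqrB X Y : frob_norm (X - Y) ^+ 2 =
  frob_dot X X - 2 * frob_dot X Y + frob_dot Y Y.
Proof.
rewrite frob_normK !(frob_dotDl, frob_dotDr, frob_dotNl, frob_dotNr)
  (frob_dotC Y X).
by ring.
Qed.

(** The curve [t |-> exp (t X)], seen from [G], is a geodesic issued from [G].
    Comparing [M] and [G] from its point at time [t > 0] bounds the slope of
    the squared distance to [M] at that point, and letting [t] go to [0] gives
    one half of the first order condition. *)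
Lemma ai_proj_slope (K : set 'M[R]_d) M G X : spd M -> spd G -> X^T = X ->
  (forall H, K H -> ai_dist M G <= ai_dist M H) ->
  (forall t, K (mxsqrt G *m mxexp (t *: X) *m mxsqrt G)) ->
  frob_dot (mxlog (whiten G M)) X <= 0.
Proof.
move=> sM sG symX minG KX.
have symq := spd_sym (spd_mxsqrt sG); have uq := mxsqrt_unit sG.
set N := whiten G M; have sN : spd N by apply: whiten_spd.
pose E t := mxexp (t *: X).
have symtX t : (t *: X)^T = t *: X by rewrite linearZ /= symX.
have sE t : spd (E t) by apply: mxexp_spd.
have symE t : (E t)^T = E t by apply: spd_sym.
have uE t : E t \in unitmx by apply: spd_unit.
have ED s t : E s *m E t = E (s + t).
  rewrite /E !mxexpZ// mxfunM//; apply: eq_mxfun => // y.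
  by rewrite -expRD mulrDl.
have E0 : E 0 = 1%:M by rewrite /E mxexpZ// -(mxfun1 symX);
  apply: eq_mxfun => // y; rewrite mul0r expR0.
have logE t : mxlog (E t) = t *: X by apply: mxexpK.
have cE (f : R -> R) l (F : set_system R) : Filter F -> f @ F --> l ->
    E (f t) @[t --> F] --> E l.
  move=> FF fl; apply: cvg_mxexp => //; apply/cvg_mxP => i j.
  rewrite mxE; under eq_cvg do rewrite mxE.
  by apply: cvgM => //; exact: cvg_cst.
have KE t : K (mxsqrt G *m E t *m mxsqrt G) by apply: KX.
clearbody E.
pose C t := E (- (t / 2)).
have symC t : (C t)^T = C t by apply: symE.
have uC t : C t \in unitmx by apply: uE.
have CC t : C t *m C t = E (- t) by rewrite ED -opprD -splitr.
pose Q t := mxlog (C t *m N *m C t).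
have sQ t : spd (C t *m N *m C t) by rewrite -{1}symC; apply: spd_congr.
have distQ t : ai_dist M (mxsqrt G *m E t *m mxsqrt G) = frob_norm (Q t).
  rewrite -{1}(whitenK M sG) -{1 3}symq ai_dist_congr// ai_dist_sym//.
  rewrite (@ai_distE _ _ _ _ (C t))// symC//.
  by rewrite /C !ED -E0; congr (E _); field.
(* [C t] whitens [E t], so [Q t] is the logarithm of [N] seen from [E t], and the
   logarithm of the identity seen from there is [- t *: X]. *)
have slope t : 0 < t -> frob_dot (Q t) X <= 0.
  move=> t0.
  have h1 : frob_norm (mxlog N) <= frob_norm (Q t).
    by rewrite -distQ -(ai_dist_log sG sM); apply: minG.
  have h2 : frob_norm (Q t - (- t) *: X) <= frob_norm (mxlog N).
    have -> : frob_norm (mxlog N) = ai_dist N 1%:M.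
      by rewrite ai_dist_sym ?(@ai_distE _ _ _ _ 1%:M) ?trmx1 ?mul1mx ?mulmx1//;
        exact: spd1.
    rewrite -(ai_dist_congr sN spd1 (uC t)) symC mulmx1 CC.
    rewrite ai_dist_sym// -logE; apply: frob_mxlogB_le_ai_dist => //.
  have := le_trans h2 h1; rewrite frob_norm_le -frob_normK frob_norm_sqrB.
  rewrite !(frob_dotZl, frob_dotZr).
  have := frob_dot_ge0 X; move: (frob_dot X X) (frob_dot (Q t) X) => x y x0 h.
  rewrite -(pmulr_rle0 _ t0); nra.
have cQ : frob_dot (Q t) X @[t --> 0^'+] --> frob_dot (mxlog N) X.
  apply: cvg_frob_dot; last exact: cvg_cst.
  have cC : C t @[t --> 0^'+] --> (1%:M : 'M[R]_d).
    have <- : E (- (0 / 2)) = 1%:M by rewrite mul0r oppr0.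
    apply: cE; apply: cvgN; apply: cvgM; last exact: cvg_cst.
    exact: cvg_within.
  apply: cvg_mxlog => //; first exact: filterE.
  rewrite -[N in X in _ --> X]mul1mx -[1%:M *m N]mulmx1.
  by do 2?apply: cvg_mulmx => //; exact: cvg_cst.
apply: (cvgr_to_le cQ); near=> t; apply: slope; near: t.
exact: nbhs_right_gt.
Unshelve. all: by end_near. Qed.

End Comparison.

(** * Existence, uniqueness and characterization of the projection *)

Section Projection.
Context {R : realType} {m n : nat}.
Variables (i0 : 'I_m) (p0 : 'I_n).
Local Notation K := (kronecker_family R m n).
Implicit Types (G H M X : 'M[R]_(n * m)).

Lemma whiten_sqrtK d (M X : 'M[R]_d) : spd M ->
  whiten M (mxsqrt M *m X *m mxsqrt M) = X.
Proof.
move=> sM; rewrite /whiten !mulmxA mulVmx ?mxsqrt_unit// mul1mx.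
by rewrite -mulmxA mulmxV ?mxsqrt_unit// mulmx1.
Qed.

Lemma vec_mx_continuous k l : continuous (@vec_mx R k l).
Proof.
move=> v; have FV : Filter (nbhs v) := nbhs_filter v.
apply/cvg_mxP => i j; rewrite mxE; under eq_cvg do rewrite mxE.
exact: coord_continuous.
Qed.

(** In logarithmic coordinates at [M] the distance to [M] is the Frobenius
    norm, so a minimizer exists on the closed set of the logarithms of [K]. *)
Lemma ai_proj_exists M : spd M -> exists G, ai_proj M K G.
Proof.
move=> sM; pose q := mxsqrt M; have symq : q^T = q := spd_sym (spd_mxsqrt sM).
have uq : q \in unitmx := mxsqrt_unit sM.
pose sym X := 2^-1 *: (X + X^T).
have symE X : X^T = X -> sym X = X.
  by move=> symX; rewrite /sym symX; apply/matrixP => i j;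
    rewrite mxscaleE mxaddE; field.
have sym_sym X : (sym X)^T = sym X
  by rewrite /sym linearZ /= linearD /= trmxK addrC.
pose F X := q *m mxexp (sym X) *m q.
have sF X : spd (F X) by rewrite /F -{1}symq; apply: spd_congr => //;
  apply: mxexp_spd.
have dF X : X^T = X -> ai_dist M (F X) = frob_norm X.
  by move=> symX; rewrite /ai_dist whiten_sqrtK// mxexpK// symE.
pose L H := mxlog (whiten M H).
have symL H : K H -> (L H)^T = L H.
  by move=> /kronecker_family_spd sH; apply/mxlog_trmx/whiten_spd.
have FL H : K H -> F (L H) = H.
  move=> KH; rewrite /F symE ?symL// /L mxlogK ?whitenK//.
  by apply: whiten_spd => //; apply: kronecker_family_spd.
pose r := ai_dist M 1%:M.
have r0 : 0 <= r by exact: frob_norm_ge0.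
pose D : set 'M[R]_(n * m) := [set X | [/\ X^T = X, frob_dot X X <= r ^+ 2 &
  kronecker_minors i0 p0 (F X)]].
have DL H : K H -> ai_dist M H <= r -> D (L H).
  move=> KH Hr; split; first exact: symL.
    by rewrite -frob_normK ler_sqr ?nnegrE ?frob_norm_ge0.
  by rewrite FL//; have := KH; rewrite (kronecker_family_minors i0 p0) => -[].
have cF (X : 'M[R]_(n * m)) : F Y @[Y --> X] --> F X.
  have FX : Filter (nbhs X) := nbhs_filter X.
  have csym : sym Y @[Y --> X] --> sym X.
    apply/cvg_mxP => i j; rewrite /sym !mxE; under eq_cvg do rewrite !mxE.
    apply: cvgM; first exact: cvg_cst.
    by apply: cvgD; exact: coord_continuous.
  apply: cvg_mulmx; last exact: cvg_cst.
  apply: cvg_mulmx; first exact: cvg_cst.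
  exact: cvg_mxexp.
have cfrob (X : 'M[R]_(n * m)) : frob_dot Y Y @[Y --> X] --> frob_dot X X.
  have FX : Filter (nbhs X) := nbhs_filter X.
  by apply: cvg_frob_dot; exact: cvg_id.
have clD : closed D.
  have -> : D = [set X | X^T - X = 0] `&`
      ((fun X => frob_dot X X) @^-1` [set x | x <= r ^+ 2] `&`
       F @^-1` (kronecker_minors i0 p0)).
    apply/seteqP; split=> X; first by move=> [sX ? ?]; split=> //=;
      rewrite sX subrr.
    by move=> [/= /eqP]; rewrite subr_eq0 => /eqP ? [].
  apply: closedI; last apply: closedI.
  - have -> : [set X : 'M[R]_(n * m) | X^T - X = 0] =
      \bigcap_(t in setT) ((fun X => X t.1 t.2 - X t.2 t.1) @^-1` [set 0]).
      apply/seteqP; split=> [X /eqP|X hX].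
        by rewrite subr_eq0 => /eqP symX [i j] _ /=;
          rewrite -[in X in X - _]symX mxE subrr.
      by apply/matrixP => i j; rewrite !mxE; apply: (hX (j, i)).
    apply: (@closed_bigI _ _ setT) => t _; apply: preimage_closed;
      last exact: closed_eq.
    move=> X _; have FX : Filter (nbhs X) := nbhs_filter X.
    by apply: cvgB; exact: coord_continuous.
  - by apply: preimage_closed => [X _|]; [exact: cfrob|exact: closed_le].
  - apply: preimage_closed => [X _|];
      [exact: cF|exact: closed_kronecker_minors].
pose D' : set 'rV[R]_(n * m * (n * m)) := vec_mx @^-1` D.
have clD' : closed D'.
  by apply: preimage_closed => // v _; exact: vec_mx_continuous.
have bD' : bounded_set D'.
  exists r; split; first exact: num_real.
  move=> s rs v [_ vr _]; apply: le_trans (ltW rs).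
  rewrite [leLHS]/Num.norm /= mx_normrE; apply/bigmax_leP;
    split=> // -[i k] _ /=.
  rewrite (ord1 i); case/mxvec_indexP: k => a b.
  have -> : v 0 (mxvec_index a b) = vec_mx v a b by rewrite mxE.
  rewrite -ler_sqr ?nnegrE// real_normK ?num_real//.
  exact: le_trans (sqr_le_frob _ _ _) vr.
have K1 : K 1%:M by exact: kronecker_family1.
have [||v] := @EVT_min_rV R _ (fun v => frob_dot (vec_mx v) (vec_mx v)) D' _
    (bounded_closed_compact bD' clD').
- exists (mxvec (L 1%:M)); rewrite /D' /= mxvecK; exact: DL.
- apply: continuous_subspaceT => v.
  exact: (cvg_comp _ _ (vec_mx_continuous (x := v)) (cfrob _)).
rewrite inE => -[]; set X := vec_mx v => symX Xr mX minX.
exists (F X); split; first by rewrite (kronecker_family_minors i0 p0); split.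
move=> H KH; rewrite dF//.
have [Hr|/ltW rH] := leP (ai_dist M H) r; last first.
  apply: le_trans rH; rewrite -ler_sqr ?nnegrE ?frob_norm_ge0//.
  by rewrite frob_normK.
have := minX (mxvec (L H)); rewrite mxvecK inE frob_norm_le; apply.
by rewrite /D' /= mxvecK; apply: DL.
Qed.

End Projection.

Section ProjectionCharacterization.
Context {R : realType} {m n : nat}.
Local Notation K := (kronecker_family R m n).
Implicit Types (G H M : 'M[R]_(n * m)).

(** The residual is tested against its own partial traces. *)
Lemma ai_proj_ptrace M G : spd M -> ai_proj M K G ->
  ptraceB (mxlog (whiten G M)) = 0 /\ ptraceA (mxlog (whiten G M)) = 0.
Proof.
move=> sM [KG minG]; have sG := kronecker_family_spd KG.
have symR := mxlog_trmx (whiten_spd sG sM).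
have symA := ptraceA_trmx symR; have symB := ptraceB_trmx symR.
split; apply: frob_dot_eq0; apply/eqP; rewrite eq_le frob_dot_ge0 andbT.
  rewrite -frob_dot_tensl; apply: (ai_proj_slope sM sG _ minG) => [|t].
    by rewrite trmx_tens trmx1 symB.
  rewrite -tensmxZr; apply: kronecker_family_congr_sqrt => //.
  by apply: mxexp_tens1l; rewrite linearZ /= symB.
rewrite -frob_dot_tensr; apply: (ai_proj_slope sM sG _ minG) => [|t].
  by rewrite trmx_tens trmx1 symA.
rewrite -tensmxZl; apply: kronecker_family_congr_sqrt => //.
by apply: mxexp_tens1r; rewrite linearZ /= symA.
Qed.

(** Vanishing partial traces make the residual orthogonal to the logarithms of
    [K] at [G], so the comparison inequality becomes a Pythagorean one. *)
Lemma ptrace0_pythagoras M G H : spd M -> K G -> K H ->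
  ptraceB (mxlog (whiten G M)) = 0 -> ptraceA (mxlog (whiten G M)) = 0 ->
  ai_dist M G ^+ 2 + frob_norm (mxlog (whiten G H)) ^+ 2 <= ai_dist M H ^+ 2.
Proof.
move=> sM KG KH trB trA.
have [sG sH] := (kronecker_family_spd KG, kronecker_family_spd KH).
have := ai_dist_ge_log sG sM sH.
rewrite -ler_sqr ?nnegrE ?frob_norm_ge0// frob_norm_sqrB.
suff -> : frob_dot (mxlog (whiten G M)) (mxlog (whiten G H)) = 0.
  by rewrite mulr0 subr0 (ai_dist_log sG sM) !frob_normK.
have [Y [Z [_ _ ->]]] := mxlog_whiten_kronecker KG KH.
rewrite frob_dotDr frob_dot_tensr frob_dot_tensl trB trA /frob_dot !trmx0.
by rewrite !mul0mx !mxtrace0 addr0.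
Qed.

(** Equality in the Pythagorean inequality forces [log (whiten G H) = 0]. *)
Lemma ptrace0_ai_proj M G : spd M -> K G ->
  ptraceB (mxlog (whiten G M)) = 0 -> ptraceA (mxlog (whiten G M)) = 0 ->
  unique (ai_proj M K) G.
Proof.
move=> sM KG trB trA.
have pyth H (KH : K H) := ptrace0_pythagoras sM KG KH trB trA.
have minG H : K H -> ai_dist M G <= ai_dist M H.
  move=> KH; rewrite -ler_sqr ?nnegrE ?frob_norm_ge0//.
  by apply: le_trans (pyth H KH); rewrite lerDl sqr_ge0.
split; first by split.
move=> H [KH minH]; have [sG sH] :=
  (kronecker_family_spd KG, kronecker_family_spd KH).
have := pyth H KH; have := minH G KG.
rewrite -ler_sqr ?nnegrE ?frob_norm_ge0// => le1 le2.
have /frob_dot_eq0 log0 : frob_dot (mxlog (whiten G H)) (mxlog (whiten G H)) =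
  0.
  apply/eqP; rewrite eq_le frob_dot_ge0 andbT -frob_normK; lra.
have := mxlogK (whiten_spd sG sH); rewrite log0.
have -> : mxexp (0 : 'M[R]_(n * m)) = 1%:M.
  rewrite -[0](scale0r (0 : 'M[R]_(n * m))) mxexpZ ?trmx0//
    -(mxfun1 (trmx0 _ _ _)).
  by apply: eq_mxfun => [|x]; rewrite ?trmx0// mul0r expR0.
by move=> e; rewrite -(whitenK H sG) -e mulmx1 mxsqrtK.
Qed.

End ProjectionCharacterization.

Lemma ai_dist_set_proj (R : realType) d (M G : 'M[R]_d) (K : set 'M[R]_d) :
  ai_proj M K G -> ai_dist_set M K = ai_dist M G.
Proof.
move=> [KG minG]; apply/eqP; rewrite eq_le; apply/andP; split.
  by apply: ge_inf; [exists (ai_dist M G) => _ [H KH <-]; exact: minG|exists G].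
by apply: lb_le_inf => [|_ [H KH <-]]; [exists (ai_dist M G), G|exact: minG].
Qed.

Theorem kronecker_projection (R : realType) (m n : nat) (hm : (1 <= m)%N)
  (hn : (1 <= n)%N) :
  let K : set 'M[R]_(n * m) := kronecker_family R m n in
  forall M : 'M[R]_(n * m), spd M ->
  exists Gstar : 'M[R]_(n * m),
  let Rstar := mxlog (whiten Gstar M) in
  [/\ unique (ai_proj M K) Gstar,
      ptraceB Rstar = 0 /\ ptraceA Rstar = 0,
      (forall G : 'M[R]_(n * m), K G ->
         ptraceB (mxlog (whiten G M)) = 0 ->
         ptraceA (mxlog (whiten G M)) = 0 -> G = Gstar)
    & ai_dist_set M K = frob_norm Rstar].
Proof.
move=> K M sM; have [G projG] := ai_proj_exists (Ordinal hm) (Ordinal hn) sM.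
have [trB trA] := ai_proj_ptrace sM projG; have [KG _] := projG.
exists G; split=> //; first exact: ptrace0_ai_proj.
  move=> H KH trB' trA'; apply: (ptrace0_ai_proj sM KH trB' trA').2.
  exact: projG.
by rewrite (ai_dist_set_proj projG) ai_dist_log//; exact: kronecker_family_spd.
Qed.

(** * The Kronecker family as an embedded submanifold *)

Section NearSpd.
Context {R : realType} {d : nat}.

(** Whitening by the limit reduces positivity to eigenvalues close to [1]. *)
Lemma near_spd T (F : set_system T) {FF : Filter F} (f : T -> 'M[R]_d) S :
  spd S -> (forall x, (f x)^T = f x) -> f @ F --> S ->
  \forall x \near F, spd (f x).
Proof.
move=> sS symf fS.
have cW : whiten S (f x) @[x --> F] --> (1%:M : 'M[R]_d).
  rewrite -(whiten_id sS); apply: cvg_mulmx; last exact: cvg_cst.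
  by apply: cvg_mulmx => //; exact: cvg_cst.
have cD : frob_dot (whiten S (f x) - 1%:M) (whiten S (f x) - 1%:M) @[x --> F]
  --> (0 : R).
  have -> : 0 = frob_dot (1%:M - 1%:M : 'M[R]_d) (1%:M - 1%:M) :> R.
    by rewrite subrr /frob_dot mulmx0 mxtrace0.
  by apply: cvg_frob_dot; apply: cvgB => //; exact: cvg_cst.
near=> x.
have : frob_dot (whiten S (f x) - 1%:M) (whiten S (f x) - 1%:M) < 1.
  by near: x; apply: (cvgr_lt 0).
have symW : (whiten S (f x))^T = whiten S (f x).
  by rewrite /whiten !trmx_mul mxinvsqrt_trmx// symf mulmxA.
have [U [s UU WE]] := symmetric_spectral symW.
have E1 : (1%:M : 'M[R]_d) = U^T *m diag_mx (const_mx 1) *m U.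
  by rewrite diag_const_mx mulmx1.
have -> : whiten S (f x) - 1%:M = U^T *m diag_mx (s - const_mx 1) *m U.
  by rewrite WE [in LHS]E1 linearB /= mulmxBr mulmxBl.
rewrite frob_diag// => h.
have sW : spd (whiten S (f x)).
  rewrite WE; apply/spd_diag => // i.
  have : (s - const_mx 1) 0 i ^+ 2 < 1.
    apply: le_lt_trans h; rewrite (bigD1 i)//= lerDl.
    by apply: sumr_ge0 => *; rewrite sqr_ge0.
  by rewrite !mxE; nra.
rewrite -(whitenK (f x) sS) -{1}(spd_sym (spd_mxsqrt sS)).
by apply: spd_congr => //; exact: mxsqrt_unit.
Unshelve. all: by end_near. Qed.

End NearSpd.

Section PolynomialMaps.
Context {R : realType} {W : normedModType R}.

(** Directional derivatives of the maps at hand, of degree at most two, are read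
    off their exact expansion. *)
Lemma is_derive_quadratic (V : normedModType R) (f : V -> W) x v D Q :
  (forall h : R, f (h *: v + x) = f x + h *: D + h ^+ 2 *: Q) ->
  is_derive x v f D.
Proof.
move=> fE.
have lim : (fun h : R => h^-1 *: ((f \o shift x) (h *: v) - f x)) @ 0^' --> D.
  have e : \forall h \near (0 : R)^', D + h *: Q =
    h^-1 *: ((f \o shift x) (h *: v) - f x).
    near=> h; have h0 : h != 0 by near: h; exact: nbhs_dnbhs_neq.
    rewrite /= fE -(addrA (f x)) addrAC subrr add0r scalerDr !scalerA mulVf//
      scale1r.
    by rewrite expr2 mulrA mulVf// mul1r.
  apply: (cvg_trans (near_eq_cvg e)).
  suff : D + h *: Q @[h --> 0^'] --> D + (0 : R) *: Q by rewrite scale0r addr0.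
  apply: cvgD; first exact: cvg_cst.
  by apply: cvgZr_tmp; exact: cvg_within.
apply: DeriveDef; first by apply/cvg_ex; exists D.
exact: cvg_lim lim.
Unshelve. all: by end_near. Qed.

Lemma differentiable_coordZ k (a : W) (j : 'I_k) (x : 'rV[R]_k) :
  differentiable (fun y : 'rV[R]_k => y 0 j *: a) x.
Proof. by apply: differentiableZl; exact: differentiable_coord. Qed.

Lemma differentiable_affine k (w0 : W) (w : 'I_k -> W) (x : 'rV[R]_k) :
  differentiable (fun y : 'rV[R]_k => w0 + \sum_j y 0 j *: w j) x.
Proof.
apply: differentiableD; first exact: differentiable_cst.
have -> : (fun y : 'rV[R]_k => \sum_j y 0 j *: w j) =
    \sum_j (fun y : 'rV[R]_k => y 0 j *: w j).
  by apply/funext => y; rewrite fct_sumE.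
by apply: differentiable_sum => j; exact: differentiable_coordZ.
Qed.

Lemma derive_affine k (w0 : W) (w : 'I_k -> W) (v x : 'rV[R]_k) :
  'D_v (fun y : 'rV[R]_k => w0 + \sum_j y 0 j *: w j) x = \sum_j v 0 j *: w j.
Proof.
suff h : is_derive x v (fun y : 'rV[R]_k => w0 + \sum_j y 0 j *: w j)
    (\sum_j v 0 j *: w j) by exact: derive_val.
apply: (@is_derive_quadratic _ _ _ _ _ 0) => h.
rewrite scaler0 addr0 -addrA scaler_sumr -big_split; congr (_ + _).
by apply: eq_bigr => j _; rewrite !mxE scalerDl scalerA addrC.
Qed.

(** The directional derivatives are constant maps, which are again affine. *)
Lemma smooth_on_affine k (U : set 'rV[R]_k) (w0 : W) (w : 'I_k -> W) :
  smooth_on U (fun y : 'rV[R]_k => w0 + \sum_j y 0 j *: w j).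
Proof.
move=> l; elim: l w0 w => [|l IH] w0 w.
  by move=> x _; apply: differentiable_continuous; exact: differentiable_affine.
split=> [x _|v]; first exact: differentiable_affine.
have -> : 'D_v (fun y : 'rV[R]_k => w0 + \sum_j y 0 j *: w j) =
    fun y => (\sum_j v 0 j *: w j) + \sum_j y 0 j *: (0 : W).
  apply/funext => x; rewrite derive_affine [X in _ + X]big1 ?addr0// => j _.
  by rewrite scaler0.
exact: IH.
Qed.

End PolynomialMaps.

Section KroneckerChart.
Context {R : realType} {m n : nat}.
Variable p0 : 'I_n.
Local Notation MM := ('M[R]_m * 'M[R]_n)%type.

(** A single linear map whose kernel is the space of pairs of symmetric matrices
    [(A, B)] with [B p0 p0 = 0]: the two terms of the second component are
    antisymmetric and symmetric, so they vanish together. *)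
Definition slice_defect (AB : MM) : MM :=
  (AB.1 - AB.1^T, AB.2 - AB.2^T + AB.2 p0 p0 *: delta_mx p0 p0).

Lemma slice_defect_is_linear : linear slice_defect.
Proof.
move=> a [A B] [A' B']; rewrite /slice_defect /=; congr (_, _).
  by apply/matrixP => i j; rewrite !mxE; ring.
by apply/matrixP => i j; rewrite !mxE; ring.
Qed.

HB.instance Definition _ :=
  GRing.isLinear.Build R MM MM *:%R slice_defect slice_defect_is_linear.

Lemma slice_defect0 A B : slice_defect (A, B) = 0 <->
  [/\ A^T = A, B^T = B & B p0 p0 = 0].
Proof.
split=> [|[symA symB B0]]; last first.
  by rewrite /slice_defect /= symA symB B0 !subrr scale0r addr0.
case=> /eqP; rewrite subr_eq0 => /eqP symA defB.
have B0 : B p0 p0 = 0.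
  by have /matrixP/(_ p0 p0) := defB; rewrite !mxE !eqxx subrr add0r mulr1.
split=> //; move: defB; rewrite B0 scale0r addr0 => /eqP.
by rewrite subr_eq0 => /eqP.
Qed.

Lemma sum_pairE I (r : seq I) (P : pred I) (F : I -> 'M[R]_m) (G : I -> 'M[R]_n)
  :
  \sum_(i <- r | P i) ((F i, G i) : MM) =
  (\sum_(i <- r | P i) F i, \sum_(i <- r | P i) G i).
Proof. by elim/big_rec3: _ => // i A B C _ ->. Qed.

(** A basis of the kernel of [slice_defect].  The dual basis is given by Frobenius
    products, so that coordinates are visibly continuous. *)
Lemma slice_basis : exists (k : nat) (a ca : 'I_k -> 'M[R]_m)
  (b cb : 'I_k -> 'M[R]_n),
  [/\ forall j, [/\ (a j)^T = a j, (b j)^T = b j & b j p0 p0 = 0],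
      forall A B, A^T = A -> B^T = B -> B p0 p0 = 0 ->
        A = \sum_j (frob_dot (ca j) A + frob_dot (cb j) B) *: a j /\
        B = \sum_j (frob_dot (ca j) A + frob_dot (cb j) B) *: b j
    & forall x : 'rV[R]_k, forall j,
        frob_dot (ca j) (\sum_l x 0 l *: a l) +
        frob_dot (cb j) (\sum_l x 0 l *: b l) = x 0 j].
Proof.
pose U : {vspace MM} := lker (linfun slice_defect).
have memU A B : ((A, B) \in U) <-> [/\ A^T = A, B^T = B & B p0 p0 = 0].
  by rewrite memv_ker lfunE /= -slice_defect0; split=> [/eqP|/eqP].
pose X := vbasis U; pose k := \dim U.
have bX : basis_of U X := vbasisP U.
pose co j (AB : MM) : R := coord X j AB.
have coE j A B : co j (A, B) =
  frob_dot (\matrix_(i, l) co j (delta_mx i l, 0)) A +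
    frob_dot (\matrix_(i, l) co j (0, delta_mx i l)) B.
  have -> : (A, B) = \sum_i \sum_l A i l *: ((delta_mx i l, 0) : MM) +
      \sum_i \sum_l B i l *: ((0, delta_mx i l) : MM).
    have -> : (A, B) = (A, 0) + (0, B) :> MM by congr (_, _);
      rewrite /= ?addr0 ?add0r.
    have fl : {morph (fun A : 'M[R]_m => (A, 0) : MM) : x y / x + y}.
      by move=> x y; congr (_, _); rewrite /= addr0.
    have fr : {morph (fun B : 'M[R]_n => (0, B) : MM) : x y / x + y}.
      by move=> x y; congr (_, _); rewrite /= addr0.
    rewrite {1}(matrix_sum_delta A) {1}(matrix_sum_delta B).
    rewrite (big_morph _ fl erefl) (big_morph _ fr erefl); congr (_ + _).
      apply: eq_bigr => i _; rewrite (big_morph _ fl erefl).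
      by apply: eq_bigr => l _; congr (_, _); rewrite /= scaler0.
    apply: eq_bigr => i _; rewrite (big_morph _ fr erefl).
    by apply: eq_bigr => l _; congr (_, _); rewrite /= scaler0.
  rewrite /co linearD !linear_sum !frob_dotE; congr (_ + _).
    apply: eq_bigr => i _; rewrite linear_sum; apply: eq_bigr => l _.
    by rewrite linearZ mxE mulrC.
  apply: eq_bigr => i _; rewrite linear_sum; apply: eq_bigr => l _.
  by rewrite linearZ mxE mulrC.
exists k, (fun j => (X`_j).1), (fun j => \matrix_(i, l) co j (delta_mx i l, 0)),
  (fun j => (X`_j).2), (fun j => \matrix_(i, l) co j (0, delta_mx i l)).
have sum_pair (c : 'I_k -> R) :
    \sum_j c j *: X`_j = (\sum_j c j *: (X`_j).1, \sum_j c j *: (X`_j).2).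
  by rewrite -sum_pairE; apply: eq_bigr => j _; case: (X`_j).
split=> [j|A B symA symB B0|x j].
- apply/memU; rewrite -surjective_pairing; apply: vbasis_mem.
  by apply: mem_nth; rewrite size_tuple; exact: ltn_ord.
- have ABU : (A, B) \in U by apply/memU.
  have := coord_vbasis ABU; rewrite sum_pair => -[eA eB].
  split; [rewrite [LHS]eA|rewrite [LHS]eB];
    by apply: eq_bigr => j _; rewrite -coE.
- rewrite -coE -sum_pair /co coord_sum_free//; exact: basis_free bX.
Qed.

End KroneckerChart.

Section KroneckerSubmanifold.
Context {R : realType} {m n : nat}.
Variables (i0 : 'I_m) (p0 : 'I_n).
Local Notation K := (kronecker_family R m n).
Local Notation e p i := (mxtens_index (p, i)).

Lemma tensmx_suml I (r : seq I) (B : I -> 'M[R]_n) (A : 'M[R]_m) :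
  (\sum_(j <- r) B j) *t A = \sum_(j <- r) B j *t A.
Proof.
apply: (big_morph (fun B => B *t A)) => [x y|]; first exact: tensmxDl.
exact: tens0mx.
Qed.

Lemma tensmx_sumr I (r : seq I) (B : 'M[R]_n) (A : I -> 'M[R]_m) :
  B *t (\sum_(j <- r) A j) = \sum_(j <- r) B *t A j.
Proof.
apply: (big_morph (fun A => B *t A)) => [x y|]; first exact: tensmxDr.
exact: tensmx0.
Qed.

(** Normalizing the entry [(p0, p0)] of the left factor to [1] makes the
    factorization [B *t A] unique, so the pairs of normalized factors form a
    single chart, whose inverse reads the factors off the entries. *)
Lemma kronecker_embedded_submanifold : embedded_submanifold K.
Proof.
have [k [a [ca [b [cb [ab_sym ab_gen ab_co]]]]]] :=
  slice_basis (R := R) (m := m) p0.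
pose alpha (x : 'rV[R]_k) : 'M[R]_m := \sum_j x 0 j *: a j.
pose beta (x : 'rV[R]_k) : 'M[R]_n := \sum_j x 0 j *: b j.
pose E0 : 'M[R]_n := delta_mx p0 p0.
pose psi (x : 'rV[R]_k) : 'M[R]_(n * m) := (E0 + beta x) *t alpha x.
pose fA (G : 'M[R]_(n * m)) : 'M[R]_m :=
  mxsub (fun i => e p0 i) (fun i => e p0 i) G.
pose fB (G : 'M[R]_(n * m)) : 'M[R]_n :=
  (G (e p0 i0) (e p0 i0))^-1 *: mxsub (fun p => e p i0) (fun p => e p i0) G.
pose phi (G : 'M[R]_(n * m)) : 'rV[R]_k :=
  \row_j (frob_dot (ca j) (fA G) + frob_dot (cb j) (fB G - E0)).
pose W := [set x | spd (E0 + beta x) /\ spd (alpha x)].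
have alphaD x y : alpha (x + y) = alpha x + alpha y.
  by rewrite /alpha -big_split; apply: eq_bigr => j _; rewrite mxE scalerDl.
have betaD x y : beta (x + y) = beta x + beta y.
  by rewrite /beta -big_split; apply: eq_bigr => j _; rewrite mxE scalerDl.
have alphaZ h x : alpha (h *: x) = h *: alpha x.
  by rewrite /alpha scaler_sumr; apply: eq_bigr => j _; rewrite mxE scalerA.
have betaZ h x : beta (h *: x) = h *: beta x.
  by rewrite /beta scaler_sumr; apply: eq_bigr => j _; rewrite mxE scalerA.
have alpha_sym x : (alpha x)^T = alpha x.
  rewrite /alpha linear_sum; apply: eq_bigr => j _.
  by rewrite linearZ /=; have [-> _ _] := ab_sym j.
have beta_sym x : (beta x)^T = beta x.
  rewrite /beta linear_sum; apply: eq_bigr => j _.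
  by rewrite linearZ /=; have [_ -> _] := ab_sym j.
have beta0 x : beta x p0 p0 = 0.
  rewrite /beta summxE big1// => j _.
  by rewrite mxE; have [_ _ ->] := ab_sym j; rewrite mulr0.
have E0E : E0 p0 p0 = 1 by rewrite mxE !eqxx.
have E0T : E0^T = E0 by rewrite trmx_delta.
have co_inj x : alpha x = 0 -> beta x = 0 -> x = 0.
  move=> ax bx; apply/rowP => j;
    rewrite mxE -ab_co -/(alpha x) -/(beta x) ax bx.
  by rewrite /frob_dot !mulmx0 !mxtrace0 addr0.
have fA_tens (B : 'M[R]_n) (A : 'M[R]_m) : B p0 p0 = 1 -> fA (B *t A) = A.
  by move=> B1; apply/matrixP => i j; rewrite mxE tensmxE B1 mul1r.
have fB_tens (B : 'M[R]_n) (A : 'M[R]_m) : B p0 p0 = 1 -> A i0 i0 != 0 ->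
  fB (B *t A) = B.
  move=> B1 A0; apply/matrixP => p q;
    rewrite /fB !mxE !mxtens_indexK /= B1 mul1r.
  by rewrite mulrC mulfK.
have phi_psi x : W x -> phi (psi x) = x.
  move=> [sB sA]; have B1 : (E0 + beta x) p0 p0 = 1
    by rewrite mxaddE beta0 addr0.
  apply/rowP => j; rewrite mxE fA_tens// fB_tens ?gt_eqF ?spd_diag_gt0//.
  by rewrite (addrC E0) addrK ab_co.
have psiK x : W x -> K (psi x) by move=> [sB sA];
  exists (alpha x), (E0 + beta x).
have Kpsi G : K G -> exists2 x, W x & psi x = G.
  move=> [A [B [sA sB GE]]]; have c0 := spd_diag_gt0 p0 sB;
    set c := B p0 p0 in c0.
  have symA : (c *: A)^T = c *: A by rewrite linearZ /= spd_sym.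
  have symB : (c^-1 *: B - E0)^T = c^-1 *: B - E0.
    by rewrite linearB linearZ /= spd_sym// E0T.
  have B0 : (c^-1 *: B - E0) p0 p0 = 0.
    by rewrite mxaddE mxoppE mxscaleE E0E mulVf ?gt_eqF// subrr.
  have [eA eB] := ab_gen _ _ symA symB B0.
  pose x : 'rV[R]_k :=
    \row_j (frob_dot (ca j) (c *: A) + frob_dot (cb j) (c^-1 *: B - E0)).
  have ax : alpha x = c *: A.
    by rewrite [RHS]eA; apply: eq_bigr => j _; rewrite mxE.
  have bx : E0 + beta x = c^-1 *: B.
    rewrite -[RHS](subrK E0) addrC; congr (_ + _).
    by rewrite [RHS]eB; apply: eq_bigr => j _; rewrite mxE.
  exists x; first by split; rewrite ?ax ?bx; apply: spd_scale;
    rewrite ?invr_gt0.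
  by rewrite /psi ax bx tensmxZl tensmxZr scalerA mulVf ?gt_eqF// scale1r.
(* [psi] is quadratic: the expansion gives its directional derivatives, and the
   latter are affine. *)
have psi_quad x v (h : R) : psi (h *: v + x) =
    psi x + h *: (beta v *t alpha x + (E0 + beta x) *t alpha v) +
    h ^+ 2 *: (beta v *t alpha v).
  rewrite /psi alphaD betaD alphaZ betaZ; apply/matrixP => r s; rewrite !mxE;
    ring.
have psi_derive x v : 'D_v psi x = beta v *t alpha x + (E0 + beta x) *t alpha v.
  have := is_derive_quadratic (psi_quad x v) => h; exact: derive_val.
have psi_diff x : differentiable psi x.
  have -> : psi = (fun y : 'rV[R]_k => 0 + \sum_j y 0 j *: (E0 *t a j)) +
      \sum_j \sum_l (fun y : 'rV[R]_k => (y 0 j * y 0 l) *: (b j *t a l)).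
    apply/funext => y; rewrite /psi tensmxDl tensmx_sumr !fctE add0r.
    congr (_ + _); first by apply: eq_bigr => j _; rewrite tensmxZr.
    rewrite fct_sumE tensmx_suml; apply: eq_bigr => j _.
    rewrite fct_sumE tensmx_sumr; apply: eq_bigr => l _.
    by rewrite tensmxZl tensmxZr scalerA.
  apply: differentiableD; first exact: differentiable_affine.
  apply: differentiable_sum => j; apply: differentiable_sum => l.
  by apply: differentiableZl; apply: differentiableM;
    exact: differentiable_coord.
have psi_smooth : smooth_on W psi.
  case=> [x _|l]; first exact: differentiable_continuous.
  split=> [x _|v]; first exact: psi_diff.
  have -> : 'D_v psi = fun y : 'rV[R]_k => E0 *t alpha v +
      \sum_j y 0 j *: (beta v *t a j + b j *t alpha v).
    apply/funext => x; rewrite psi_derive tensmxDl addrCA; congr (_ + _).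
    rewrite tensmx_sumr tensmx_suml -big_split; apply: eq_bigr => j _.
    by rewrite scalerDr tensmxZl tensmxZr.
  exact: smooth_on_affine.
exists k => p Kp; exists setT, W, psi, phi; split=> //.
- split=> //; first exact: openT.
    rewrite openE => x [sB sA]; have FX : Filter (nbhs x) := nbhs_filter x.
    have calpha : alpha y @[y --> x] --> alpha x.
      apply/cvg_mxP => i j; rewrite /alpha summxE;
        under eq_cvg do rewrite summxE.
      apply: cvg_sumr => l; rewrite mxE; under eq_cvg do rewrite mxE.
      by apply: cvgM; [exact: coord_continuous|exact: cvg_cst].
    have cbeta : E0 + beta y @[y --> x] --> E0 + beta x.
      apply: cvgD; first exact: cvg_cst.
      apply/cvg_mxP => i j; rewrite /beta summxE;
        under eq_cvg do rewrite summxE.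
      apply: cvg_sumr => l; rewrite mxE; under eq_cvg do rewrite mxE.
      by apply: cvgM; [exact: coord_continuous|exact: cvg_cst].
    have sym_beta y : (E0 + beta y)^T = E0 + beta y
      by rewrite linearD /= E0T beta_sym.
    exact: (filterI (near_spd sB sym_beta cbeta)
      (near_spd sA alpha_sym calpha)).
  rewrite setIT; apply/seteqP; split=> [_ [x Wx <-]|G KG]; first exact: psiK.
  by have [x Wx <-] := Kpsi G KG; exists x.
- move=> x [sB sA]; apply: raddf_inj => v.
  have A0 := spd_diag_gt0 i0 sA.
  have B1 : (E0 + beta x) p0 p0 = 1 by rewrite mxaddE beta0 addr0.
  move=> dv0.
  have /matrixP d0 : beta v *t alpha x + (E0 + beta x) *t alpha v = 0.
    by rewrite -psi_derive deriveE//; exact: dv0.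
  have av : alpha v = 0.
    apply/matrixP => i j; have := d0 (e p0 i) (e p0 j).
    by rewrite mxaddE !tensmxE beta0 B1 mul0r add0r mul1r !mxE.
  apply: co_inj => //; apply/matrixP => q r; have := d0 (e q i0) (e r i0).
  rewrite mxaddE !tensmxE av [(0 : 'M[R]_m) _ _]mxE mulr0 addr0 !mxE => /eqP.
  by rewrite mulf_eq0 (gt_eqF A0) orbF => /eqP.
- apply: continuous_in_subspaceT => G; rewrite inE => -[KG _].
  have FG : Filter (nbhs G) := nbhs_filter G.
  have sG := kronecker_family_spd KG.
  have g0 := spd_diag_gt0 (e p0 i0) sG.
  apply/cvg_mxP => r j; rewrite /phi mxE; under eq_cvg do rewrite mxE.
  apply: cvgD; apply: cvg_frob_dot; try exact: cvg_cst.
    apply/cvg_mxP => i l; rewrite mxE; under eq_cvg do rewrite mxE.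
    exact: coord_continuous.
  apply: cvgB; last exact: cvg_cst.
  apply/cvg_mxP => q l; rewrite !mxE; under eq_cvg do rewrite !mxE.
  apply: cvgM; last exact: coord_continuous.
  by apply: cvgV; [rewrite gt_eqF|exact: coord_continuous].
Qed.

End KroneckerSubmanifold.

(** * Derivatives of curves of matrices *)

Section MatrixCurves.
Context {R : realType}.
Implicit Types t : R.

Lemma is_derive_mxP m n (f : R -> 'M[R]_(m, n)) t D :
  is_derive t 1 f D <-> forall i j, is_derive t 1 (fun s => f s i j) (D i j).
Proof.
split=> [[df <-] i j|h].
  by rewrite (derive_mx df) mxE; apply/derivableP; move/derivable_mxP: df.
have df : derivable f t 1 by apply/derivable_mxP => i j; case: (h i j).
apply: DeriveDef => //; rewrite (derive_mx df); apply/matrixP => i j.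
by rewrite mxE; case: (h i j).
Qed.

Lemma is_derive_sumE n (h : 'I_n -> R -> R) t (dh : 'I_n -> R) :
  (forall i, is_derive t 1 (h i) (dh i)) ->
  is_derive t 1 (fun s => \sum_i h i s) (\sum_i dh i).
Proof.
move=> hd; have -> : (fun s => \sum_i h i s) = \sum_i h i.
  by apply/funext => s; rewrite fct_sumE.
exact: is_derive_sum.
Qed.

Lemma is_derive_mulE (f g : R -> R) t df dg :
  is_derive t 1 f df -> is_derive t 1 g dg ->
  is_derive t 1 (fun s => f s * g s) (df * g t + f t * dg).
Proof.
move=> hf hg; have := is_deriveM hf hg => h; apply: is_derive_eq.
by rewrite /GRing.scale /= addrC (mulrC df).
Qed.

Lemma is_derive_mulmx m n p (f : R -> 'M[R]_(m, n)) (g : R -> 'M[R]_(n, p)) t df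
  dg :
  is_derive t 1 f df -> is_derive t 1 g dg ->
  is_derive t 1 (fun s => f s *m g s) (df *m g t + f t *m dg).
Proof.
move=> /is_derive_mxP hf /is_derive_mxP hg; apply/is_derive_mxP => i j.
have -> : (fun s => (f s *m g s) i j) = (fun s => \sum_k f s i k * g s k j).
  by apply/funext => s; rewrite mxE.
by rewrite !mxE -big_split; apply: is_derive_sumE => k; exact: is_derive_mulE.
Qed.

Lemma is_derive_mulmxl m n p (A : 'M[R]_(m, n)) (g : R -> 'M[R]_(n, p)) t dg :
  is_derive t 1 g dg -> is_derive t 1 (fun s => A *m g s) (A *m dg).
Proof.
move=> hg; have := is_derive_mulmx (is_derive_cst A t 1) hg => h.
by apply: is_derive_eq; rewrite mul0mx add0r.
Qed.

Lemma is_derive_mulmxr m n p (f : R -> 'M[R]_(m, n)) (B : 'M[R]_(n, p)) t df :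
  is_derive t 1 f df -> is_derive t 1 (fun s => f s *m B) (df *m B).
Proof.
move=> hf; have := is_derive_mulmx hf (is_derive_cst B t 1) => h.
by apply: is_derive_eq; rewrite mulmx0 addr0.
Qed.

Lemma is_derive_mxtrace n (f : R -> 'M[R]_n) t df :
  is_derive t 1 f df -> is_derive t 1 (fun s => \tr (f s)) (\tr df).
Proof. by move=> /is_derive_mxP hf; apply: is_derive_sumE => i. Qed.

Lemma is_derive_tensmx m n (f : R -> 'M[R]_n) (g : R -> 'M[R]_m) t df dg :
  is_derive t 1 f df -> is_derive t 1 g dg ->
  is_derive t 1 (fun s => f s *t g s) (df *t g t + f t *t dg).
Proof.
move=> /is_derive_mxP hf /is_derive_mxP hg; apply/is_derive_mxP => k l.
case: (mxtens_indexP k) => p i; case: (mxtens_indexP l) => q j.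
have -> : (fun s => (f s *t g s) (mxtens_index (p, i)) (mxtens_index (q, j))) =
    (fun s => f s p q * g s i j) by apply/funext => s; rewrite tensmxE.
by rewrite mxaddE !tensmxE; exact: is_derive_mulE.
Qed.

Lemma is_derive_cvg m n (f : R -> 'M[R]_(m, n)) t D :
  is_derive t 1 f D -> f @ t --> f t.
Proof.
by case=> /derivable1_diffP/differentiable_continuous.
Qed.

(** The difference quotient of the inverse is exactly
    [- f(t + h)^-1 ((f(t + h) - f(t)) / h) f(t)^-1]. *)
Lemma is_derive_invmx n (f : R -> 'M[R]_n) t D :
  f t \in unitmx -> is_derive t 1 f D ->
  is_derive t 1 (fun s => invmx (f s)) (- (invmx (f t) *m D *m invmx (f t))).
Proof.
move=> uf df; have cf := is_derive_cvg df.
have cfs : f (h *: 1 + t) @[h --> 0^'] --> f t.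
  apply: (cvg_comp (fun h : R => h *: 1 + t) f _ cf).
  have : (fun h : R => h *: (1 : R) + t) @ (0 : R) --> (0 : R) *: (1 : R) + t.
    by apply: cvgD; [apply: cvgZr_tmp; exact: cvg_id|exact: cvg_cst].
  by rewrite scale0r add0r; apply: cvg_trans; apply: cvg_app; exact: cvg_within.
have uf0 : \det (f t) != 0 by rewrite -unitfE -unitmxE.
have lim : (fun h : R =>
  h^-1 *: (((fun s => invmx (f s)) \o shift t) (h *: 1) - invmx (f t))) @ 0^'
  -->
    - (invmx (f t) *m D *m invmx (f t)).
  have e : \forall h \near (0 : R)^',
      - (invmx (f (h *: 1 + t)) *m (h^-1 *: (f (h *: 1 + t) - f t)) *m invmx
          (f t)) =
      h^-1 *: (((fun s => invmx (f s)) \o shift t) (h *: 1) - invmx (f t)).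
    near=> h; rewrite /=.
    have uh : f (h *: 1 + t) \in unitmx.
      rewrite unitmxE unitfE; near: h; apply: cvgr_neq0 uf0; exact: cvg_det.
    rewrite -scalemxAr -scalemxAl -scalerN; congr (_ *: _).
    by rewrite mulmxBr mulVmx// mulmxBl mul1mx -mulmxA mulmxV// mulmx1 opprB.
  apply: (cvg_trans (near_eq_cvg e)); apply: cvgN.
  apply: cvg_mulmx; last exact: cvg_cst.
  apply: cvg_mulmx; first exact: cvg_invmx.
  by case: df => /= dft <-; exact: dft.
apply: DeriveDef; first by apply/cvg_ex; eexists; exact: lim.
exact: cvg_lim lim.
Unshelve. all: by end_near. Qed.

Lemma is_derive_sym n (f : R -> 'M[R]_n) t D :
  (\forall s \near t, (f s)^T = f s) -> is_derive t 1 f D -> D^T = D.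
Proof.
move=> symf /is_derive_mxP df; apply/matrixP => i j; rewrite mxE.
have [_ <-] := df j i; have [_ <-] := df i j; apply: near_eq_derive.
by apply: filterS symf => s /matrixP/(_ i j); rewrite mxE.
Qed.

Lemma derive0_constant n (f : R -> 'M[R]_n) a b :
  (forall t, t \in `]a, b[ -> is_derive t 1 f 0) ->
  {in `]a, b[ &, forall s t, f s = f t}.
Proof.
move=> f0; suff wl s t : s \in `]a, b[ -> t \in `]a, b[ -> s < t -> f s = f t.
  move=> s t sab tab; have [st|ts|->//] := ltgtP s t; first exact: wl.
  by apply/esym/wl.
move=> sab tab st; apply/matrixP => i j.
have sub x : x \in `[s, t] -> x \in `]a, b[.
  move: sab tab; rewrite !in_itv /= => /andP[as_ _] /andP[_ tb] /andP[sx xt].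
  by rewrite (lt_le_trans as_)// (le_lt_trans xt).
have d x : x \in `[s, t] -> is_derive x 1 (fun y => f y i j) 0.
  by move=> /sub /f0 /is_derive_mxP /(_ i j); rewrite mxE.
have cf : {within `[s, t], continuous (fun y => f y i j)}.
  by apply: derivable_within_continuous => x /d [].
have d' x : x \in `]s, t[ -> is_derive x 1 (fun y => f y i j) 0.
  by move=> xst; apply: d; exact: subset_itv_oo_cc.
have [x _] := MVT st d' cf.
by rewrite mul0r => /eqP; rewrite subr_eq0 => /eqP.
Qed.

End MatrixCurves.

(** * The geodesic equation *)

Section Christoffel.
Context {R : realType} {d : nat}.
Implicit Types (S T X Y Z V : 'M[R]_d).

Lemma ai_dotE S Y Z : spd S -> Y^T = Y ->
  ai_dot S Y Z = \tr (invmx S *m Y *m invmx S *m Z).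
Proof.
move=> sS symY; rewrite /ai_dot /frob_dot /whiten !trmx_mul mxinvsqrt_trmx//
  symY.
by rewrite -(mxinvsqrtK sS) !mulmxA mxtrace_mulC !mulmxA.
Qed.

Lemma derive_line (W : normedModType R) (f : 'M[R]_d -> W) S X :
  'D_X f S = 'D_1 (fun h : R => f (h *: X + S)) 0.
Proof.
rewrite /derive; set g1 := fun h => h^-1 *: _; set g2 := fun h => h^-1 *: _.
suff -> : g1 = g2 by [].
by rewrite funeqE /g1 /g2 => h /=; rewrite addr0 scale0r add0r [_%:A]mulr1.
Qed.

Lemma is_derive_line S X : is_derive (0 : R) 1 (fun h : R => h *: X + S) X.
Proof.
apply: (@is_derive_quadratic _ _ _ _ _ _ _ 0) => h.
by rewrite scaler0 addr0 addr0 scale0r add0r addrC [_%:A]mulr1.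
Qed.

(** On positive-definite matrices [ai_dot T Y Z = tr (T^-1 Y T^-1 Z)], and the
    line from [S] in a symmetric direction stays there for small times. *)
Lemma derive_ai_dot S X Y Z : spd S -> X^T = X -> Y^T = Y ->
  let P := invmx S in
  'D_X (fun T : 'M[R]_d => ai_dot T Y Z) S =
  - (\tr (P *m X *m P *m Y *m P *m Z) + \tr (P *m Y *m P *m X *m P *m Z)).
Proof.
move=> sS symX symY P; rewrite derive_line.
have line := is_derive_line S X.
have uS : 0 *: X + S \in unitmx by rewrite scale0r add0r spd_unit.
have dinv := is_derive_invmx uS line; rewrite scale0r add0r -/P in dinv.
have sT : \forall h \near (0 : R), spd (h *: X + S).
  have c0 := is_derive_cvg line.
  have s0 : spd ((0 : R) *: X + S) by rewrite scale0r add0r.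
  have symh (h : R) : (h *: X + S)^T = h *: X + S.
    by rewrite linearD linearZ /= symX spd_sym.
  exact: (near_spd s0 symh c0).
have e : \forall h \near (0 : R),
    ai_dot (h *: X + S) Y Z =
      \tr (invmx (h *: X + S) *m Y *m invmx (h *: X + S) *m Z).
  by apply: filterS sT => h sh; rewrite ai_dotE.
rewrite (near_eq_derive _ e).
have := is_derive_mxtrace (is_derive_mulmxr Z
  (is_derive_mulmx (is_derive_mulmxr Y dinv) dinv)).
case=> _ ->; rewrite scale0r add0r -/P !(mulNmx, mulmxN) !mulmxA.
by rewrite mulmxDl !mulNmx mxtraceD !raddfN /= opprD.
Qed.

Lemma symmetric_tr0 N : N^T = N -> (forall Z, Z^T = Z -> \tr (N *m Z) = 0) ->
  N = 0.
Proof.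
by move=> symN h; apply: frob_dot_eq0; rewrite /frob_dot symN h.
Qed.

(** With [P = S^-1], all the terms of the Christoffel symbol are cyclically equal
    to [tr (P V P V P Z)]; so [P (A - V P V) P], which is symmetric, is orthogonal
    to every symmetric [Z]. *)
Lemma geodesic_equation S V A : spd S -> V^T = V -> A^T = A ->
  (forall Z, Z \is symmetricmx -> ai_dot S A Z + ai_christoffel S V V Z = 0) ->
  A = V *m invmx S *m V.
Proof.
move=> sS symV symA geo; set P := invmx S.
have symP : P^T = P by apply/spd_sym/spd_invmx.
have uS := spd_unit sS.
suff N0 : P *m (A - V *m P *m V) *m P = 0.
  have := congr1 (fun N => S *m N *m S) N0.
  rewrite /= mulmx0 mul0mx !mulmxA mulmxV// mul1mx -mulmxA mulVmx// mulmx1.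
  by move/eqP; rewrite subr_eq0 => /eqP.
apply: symmetric_tr0 => [|Z symZ].
  by rewrite !trmx_mul linearB /= !trmx_mul symP symV symA !mulmxA.
have := geo Z ((symmetricmxP Z).2 symZ).
rewrite /ai_christoffel !derive_ai_dot// ai_dotE// -/P.
rewrite mulmxBr mulmxBl mulmxBl raddfB /= !mulmxA.
have -> : \tr (P *m Z *m P *m V *m P *m V) = \tr (P *m V *m P *m V *m P *m Z).
  by rewrite -!mulmxA mxtrace_mulC -!mulmxA mxtrace_mulC -!mulmxA.
have -> : \tr (P *m V *m P *m Z *m P *m V) = \tr (P *m V *m P *m V *m P *m Z).
  by rewrite -(mulmxA _ P V) mxtrace_mulC !mulmxA.
lra.
Qed.

Lemma is_derive_mxexp Y (t0 t : R) : Y^T = Y ->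
  is_derive t 1 (fun s : R => mxexp ((s - t0) *: Y))
    (mxexp ((t - t0) *: Y) *m Y).
Proof.
move=> symY; have [U [x UU YE]] := symmetric_spectral symY.
have eE s : mxexp ((s - t0) *: Y) =
    U^T *m diag_mx (\row_k expR ((s - t0) * x 0 k)) *m U.
  rewrite mxexpZ// (mxfunE _ UU YE).
  by congr (_ *m diag_mx _ *m _); apply/rowP => k; rewrite !mxE.
have -> : (fun s : R => mxexp ((s - t0) *: Y)) =
    fun s => U^T *m diag_mx (\row_k expR ((s - t0) * x 0 k)) *m U.
  exact/funext.
rewrite eE [in X in _ *m X]YE orthogonal_diagM//.
apply: is_derive_mulmxr; apply: is_derive_mulmxl.
apply/is_derive_mxP => i j; rewrite !mxE.
have -> : (fun s : R => diag_mx (\row_k expR ((s - t0) * x 0 k)) i j) =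
    (fun s => expR ((s - t0) * x 0 i) *+ (i == j)).
  by apply/funext => s; rewrite !mxE.
have de : is_derive t 1 (fun s : R => expR ((s - t0) * x 0 i))
  (expR ((t - t0) * x 0 i) * x 0 i).
  have dl : is_derive t 1 (fun s : R => (s - t0) * x 0 i) (x 0 i).
    apply: (@is_derive_quadratic _ _ _ _ _ _ _ 0) => h.
    by rewrite scaler0 addr0 /GRing.scale /=; ring.
  have := @is_derive1_comp _ expR (fun s : R => (s - t0) * x 0 i) t _ _
    (is_derive_expR _) dl => h.
  exact: h.
case: (i == j); rewrite ?mulr1n ?mulr0n//.
exact: is_derive_cst.
Qed.

(** The curve [S^(1/2) exp ((t - t0) whiten S V) S^(1/2)], characterized by the
    linear equation that it solves. *)
Lemma spd_geodesic S V (t0 : R) : spd S -> V^T = V ->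
  exists g : R -> 'M[R]_d, [/\ g t0 = S, forall t, spd (g t) &
    forall t : R, is_derive t 1 g (g t *m (invmx S *m V))].
Proof.
move=> sS symV; pose q := mxsqrt S; pose P := mxinvsqrt S.
have symq : q^T = q by apply/spd_sym/spd_mxsqrt.
have symP : P^T = P by apply: mxinvsqrt_trmx.
have uq : q \in unitmx by apply: mxsqrt_unit.
pose Y := whiten S V.
have symY : Y^T = Y by rewrite /Y /whiten !trmx_mul -/P symP symV mulmxA.
have symtY t : ((t - t0) *: Y)^T = (t - t0) *: Y by rewrite linearZ /= symY.
exists (fun t => q *m mxexp ((t - t0) *: Y) *m q); split=> [|t|t].
- rewrite subrr mxexpZ//.
  have -> : mxfun (fun x => expR (0 * x)) Y = 1%:M.
    by rewrite -(mxfun1 symY); apply: eq_mxfun => // x; rewrite mul0r expR0.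
  by rewrite mulmx1 mxsqrtK.
- by rewrite -{1}symq; apply: spd_congr => //; apply: mxexp_spd.
- have := is_derive_mulmxr q (is_derive_mulmxl q (is_derive_mxexp t0 t symY)) =>
    h.
  apply: is_derive_eq; rewrite -!mulmxA; do 2!congr (_ *m _).
  rewrite -(mxinvsqrtK sS) -/P /Y /whiten -/P !mulmxA mulmxV// mul1mx.
  by rewrite -mulmxA mulVmx ?mulmx1.
Qed.

End Christoffel.

(** * Geodesics tangent to the Kronecker family *)

Section TotallyGeodesic.
Context {R : realType} {m n : nat}.
Variables (i0 : 'I_m) (p0 : 'I_n).
Local Notation K := (kronecker_family R m n).
Local Notation e p i := (mxtens_index (p, i)).

Lemma smooth_is_derive (W : normedModType R) (U : set R) (c : R -> W) t :
  smooth_on U c -> U t -> is_derive t 1 c (derive1 c t).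
Proof.
move=> /(_ 1) [dc _] Ut; rewrite derive1E; apply: derivableP.
exact/derivable1_diffP/dc.
Qed.

Lemma smooth_derive1 (W : normedModType R) (U : set R) (c : R -> W) :
  smooth_on U c -> smooth_on U (derive1 c).
Proof.
move=> sc l; have [_ /(_ 1)] := sc l.+1.
by have -> : derive1 c = 'D_1 c by apply/funext => t; rewrite derive1E.
Qed.

(** Differentiating the identity [c_(p0 i0)(p0 i0) c = B(c) *t A(c)], where
    [A(c)] and [B(c)] are blocks of [c], along a curve in [K]. *)
Lemma tangent_kronecker (A : 'M[R]_m) (B : 'M[R]_n) v : spd A -> spd B ->
  tangent K (B *t A) v ->
  exists (Z : 'M[R]_m) (Y : 'M[R]_n),
    [/\ Z^T = Z, Y^T = Y & v = Y *t A + B *t Z].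
Proof.
move=> sA sB [r [c [r0 sc Kc c0 dc]]].
have zr : (0 : R) \in `]- r, r[ by rewrite in_itv /= oppr_lt0 r0.
have der : is_derive (0 : R) 1 c v by rewrite -dc;
  exact: smooth_is_derive sc zr.
have nearK : \forall t \near (0 : R), K (c t).
  by near=> t; apply: Kc; near: t; exact: near_in_itvoo.
pose fA (G : 'M[R]_(n * m)) : 'M[R]_m :=
  mxsub (fun i => e p0 i) (fun i => e p0 i) G.
pose fB (G : 'M[R]_(n * m)) : 'M[R]_n :=
  mxsub (fun p => e p i0) (fun p => e p i0) G.
have derE k l : is_derive (0 : R) 1 (fun t => c t k l) (v k l).
  by move/is_derive_mxP : der.
have symv : v^T = v.
  apply: is_derive_sym der; apply: filterS nearK => t Kt.
  exact/spd_sym/kronecker_family_spd.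
have symA : (fA v)^T = fA v by apply/matrixP => i j;
  rewrite !mxE -[in LHS]symv mxE.
have symB : (fB v)^T = fB v by apply/matrixP => i j;
  rewrite !mxE -[in LHS]symv mxE.
have A0 := spd_diag_gt0 i0 sA; have B0 := spd_diag_gt0 p0 sB.
set a := A i0 i0 in A0; set b := B p0 p0 in B0.
have vE p q i j : v (e p0 i0) (e p0 i0) * (B p q * A i j) + (b * a) * v (e p i)
  (e q j) =
    v (e p i0) (e q i0) * (b * A i j) + (B p q * a) * v (e p0 i) (e p0 j).
  have c0E p' q' i' j' : c 0 (e p' i') (e q' j') = B p' q' * A i' j'.
    by rewrite c0 tensmxE.
  have h1 := is_derive_mulE (derE (e p0 i0) (e p0 i0)) (derE (e p i) (e q j)).
  have h2 := is_derive_mulE (derE (e p i0) (e q i0)) (derE (e p0 i) (e p0 j)).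
  rewrite !c0E -/a -/b in h1 h2.
  have [_ <-] := h1; have [_ <-] := h2; apply: near_eq_derive.
  apply: filterS nearK => t; rewrite (kronecker_family_minors i0 p0) => -[+ _].
  exact.
pose g := v (e p0 i0) (e p0 i0).
exists (b^-1 *: fA v - (g / (b * a)) *: A), (a^-1 *: fB v); split.
- by rewrite linearB !linearZ /= symA spd_sym.
- by rewrite linearZ /= symB.
have a0 : a != 0 by rewrite gt_eqF.
have b0 : b != 0 by rewrite gt_eqF.
apply/matrixP => k l; case: (mxtens_indexP k) => p i;
  case: (mxtens_indexP l) => q j.
rewrite mxaddE !tensmxE !mxE.
apply: (mulfI (mulf_neq0 b0 a0)).
have -> : b * a * v (e p i) (e q j) = v (e p i0) (e q i0) * (b * A i j) +
    (B p q * a) * v (e p0 i) (e p0 j) - g * (B p q * A i j).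
  by rewrite -vE -/g; ring.
field; by rewrite a0 b0.
Unshelve. all: by end_near. Qed.

(** A geodesic satisfies [c' = c X] with [X] constant; if [c] is tangent to [K]
    then [X = Y *t 1 + 1 *t Z], and the Kronecker product of the geodesics
    generated by [Y] and [Z] solves the same equation. *)
Lemma kronecker_totally_geodesic : ai_totally_geodesic K.
Proof.
move=> a b t0 c t0ab [sc spdc geo] [A [B [sA sB c0E]]].
rewrite c0E => /(tangent_kronecker sA sB)[Z [Y [symZ symY dc0]]].
have dc t : t \in `]a, b[ -> is_derive t 1 c (derive1 c t).
  by move=> tab; exact: smooth_is_derive sc tab.
have ddc t : t \in `]a, b[ -> is_derive t 1 (derive1 c) (derive1n 2 c t).
  by move=> tab; rewrite derive1nS derive1n1;
    exact: smooth_is_derive (smooth_derive1 sc) tab.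
have nearab t : t \in `]a, b[ -> \forall s \near t, s \in `]a, b[.
  by move=> tab; exact: near_in_itvoo.
have symd t : t \in `]a, b[ -> (derive1 c t)^T = derive1 c t.
  move=> tab; apply: is_derive_sym (dc t tab).
  by apply: filterS (nearab t tab) => s sab; exact/spd_sym/spdc.
have symdd t : t \in `]a, b[ -> (derive1n 2 c t)^T = derive1n 2 c t.
  move=> tab; apply: is_derive_sym (ddc t tab).
  by apply: filterS (nearab t tab) => s sab; exact: symd.
pose X t := invmx (c t) *m derive1 c t.
have dX t : t \in `]a, b[ -> is_derive t 1 X 0.
  move=> tab; have uc := spd_unit (spdc t tab).
  have := is_derive_mulmx (is_derive_invmx uc (dc t tab)) (ddc t tab) => h.
  apply: is_derive_eq.
  rewrite (geodesic_equation (spdc t tab) (symd t tab) (symdd t tab)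
    (geo t tab)).
  by rewrite mulNmx !mulmxA addNr.
have Xc t : t \in `]a, b[ -> derive1 c t = c t *m X t0.
  move=> tab; rewrite (derive0_constant dX t0ab tab) /X mulmxA.
  by rewrite mulmxV ?mul1mx//; exact/spd_unit/spdc.
have uA := spd_unit sA; have uB := spd_unit sB.
have X0E : X t0 = (invmx B *m Y) *t 1%:M + 1%:M *t (invmx A *m Z).
  rewrite /X c0E dc0 invmx_tens// mulmxDr !tensmx_mul !mulVmx//.
have [ga [ga0 sga dga]] := spd_geodesic t0 sA symZ.
have [gb [gb0 sgb dgb]] := spd_geodesic t0 sB symY.
pose g t := gb t *t ga t.
have sg t : spd (g t) by apply: spd_tens.
have dg (t : R) : is_derive t 1 g (g t *m X t0).
  have := is_derive_tensmx (dgb t) (dga t) => h; apply: is_derive_eq.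
  by rewrite X0E mulmxDr !tensmx_mul !mulmx1.
have ug t : g t \in unitmx by apply: spd_unit.
have dcg t : t \in `]a, b[ -> is_derive t 1 (fun s => c s *m invmx (g s)) 0.
  move=> tab; have := is_derive_mulmx (dc t tab) (is_derive_invmx (ug t) (dg t))
    => h.
  apply: is_derive_eq.
  by rewrite (Xc t tab) mulmxN !mulmxA mulmxKV// -mulmxA mulmxA subrr.
have cg t : t \in `]a, b[ -> c t = g t.
  move=> tab; have := derive0_constant dcg t0ab tab.
  rewrite /= c0E /g ga0 gb0 -/(g t) mulmxV; last by apply: spd_unit;
    exact: spd_tens.
  by move=> /(congr1 (mulmx^~ (g t))); rewrite /= mul1mx mulmxKV.
apply: filterS (nearab t0 t0ab) => t tab; rewrite cg//.
by exists (ga t), (gb t).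
Qed.

End TotallyGeodesic.

(** * The projection onto the Kronecker family *)

Theorem theorem5p9 (R : realType) (m n : nat) (hm : (1 <= m)%N) (hn : (1 <= n)%N) :
  let K : set 'M[R]_(n * m) := kronecker_family R m n in
  [/\ K `<=` spd, closed_in spd K, embedded_submanifold K
    & ai_totally_geodesic K] /\
  forall M : 'M[R]_(n * m), spd M ->
  exists Gstar : 'M[R]_(n * m),
  let Rstar := mxlog (whiten Gstar M) in
  [/\ unique (ai_proj M K) Gstar,
      ptraceB Rstar = 0 /\ ptraceA Rstar = 0,
      (forall G : 'M[R]_(n * m), K G ->
         ptraceB (mxlog (whiten G M)) = 0 ->
         ptraceA (mxlog (whiten G M)) = 0 -> G = Gstar)
    & ai_dist_set M K = frob_norm Rstar].
Proof.
pose i0 := Ordinal hm; pose p0 := Ordinal hn.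
split; last exact: kronecker_projection.
split.
- exact: kronecker_family_spd.
- exact: (closed_in_kronecker_family i0 p0).
- exact: (kronecker_embedded_submanifold i0 p0).
- exact: (kronecker_totally_geodesic i0 p0).
Qed.
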